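(* Let $\Gamma=\{[L_v]\}_v$ be a convex lattice configuration in the standard apartment $\mathcal A$ of $\mathfrak B_d$ and let $0<r<d$. Then $\mathfrak U_\Gamma:=\{U_{\mathbf x}\mid\mathbf x\in\mathbf{adm}_r(\Gamma)\}$ is an open cover of $LG_r(\Gamma)$. Moreover, for each $\mathbf x\in\mathbf{adm}_r(\Gamma)$, the Bruhat stratum $S_{\mathbf x}$ is contained in $U_{\mathbf x}$.
   Context: SETTING. $R$ is a discrete valuation ring with fraction field $K$, uniformizer $\pi$ and algebraically closed residue field $\kappa$; $0<r<d$ are integers; $e_1,\dots,e_d$ is the standard basis of $K^d$. A lattice in $K^d$ is a free $R$-submodule $L\subset K^d$ with $L\otimes_RK\to K^d$ an isomorphism; $[L]$ is its homothety class. Distinct classes are adjacent if they have representatives with $\pi L_1\subset L_2\subset L_1$; $\mathfrak B_d$ is the flag complex of homothety classes under adjacency. The standard apartment $\mathcal A$ consists of the classes $[\langle\pi^{c_1}e_1,\dots,\pi^{c_d}e_d\rangle]$, $c_k\in\mathbb Z$. A convex lattice configuration is a finite nonempty set $\Gamma$ of classes such that $[L_1\cap L_2]\in\Gamma$ for any representatives $L_1,L_2$ of two members of $\Gamma$. Write $\overline L=L/\pi L$. LINKED GRASSMANNIAN. $LG_r(\Gamma)$ is the projective $R$-scheme whose $T$-points are collections of rank-$r$ sub-bundles $E_v\subset L_v\otimes\mathcal O_T$ ($v\in\Gamma$) such that for every inclusion $\pi^k:L_u\hookrightarrow L_v$ ($k\in\mathbb Z$) the induced map $L_u\otimes\mathcal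 O_T\to L_v\otimes\mathcal O_T$ sends $E_u$ into $E_v$; $LG_r(\Gamma)_0$ is its special fiber. ADMISSIBLE COLLECTIONS. For $a\in\mathbb Z^d$ put $L(a)=\langle\pi^{-a(1)}e_1,\dots,\pi^{-a(d)}e_d\rangle$. $\widetilde W=\mathbb S_d\ltimes\mathbb Z^d$ is the group of transformations $(\sigma,v):a\mapsto(a(\sigma^{-1}(1)),\dots,a(\sigma^{-1}(d)))+v$ of $\mathbb Z^d$; $W_a\subset\widetilde W$ consists of those with $\sum_kv(k)=0$. Let $\tau_j$ $(j\in\mathcal J)$ be the maximal simplices of the complex spanned by $\Gamma$ (maximal sets of pairwise adjacent classes). Choose representatives $L_v=L(a_v)$ such that those of the vertices of each $\tau_j$ can be ordered as $L_0\subset L_1\subset\dots\subset\pi^{-1}L_0$. Let $W_j$ (resp. $W_{j,j'}$) be the subgroup of $W_a$ fixing $a_v$ for all $v\in\tau_j$ (resp. $v\in\tau_j\cap\tau_{j'}$). Call a coset $hW_j$, $h\in\widetilde W$, admissible for $\tau_j$ if $a_v\le h\cdot a_v\le a_v+(1,\dots,1)$ coordinatewise and $\sum_k (h\cdot a_v)(k)-\sum_k a_v(k)=r$ for all $v\in\tau_j$. $\mathbf{adm}_r(\Gamma)$ is the set of $\Gamma$-admissible collections of size $r$: tuples $\mathbf x=(h_jW_j)_{j\in\mathcal J}$ with $h_jW_j$ admissible for $\tau_j$ for each $j$ and $W_{j,j'}h_jW_{j,j'}=W_{j,j'}h_{j'}W_{j,j'}$ for all $j,j'$. OPEN SETS.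 For $\mathbf x=(h_jW_j)_j\in\mathbf{adm}_r(\Gamma)$ let $C_j$ be the set of tuples $\mathbf x'=(\mathbf x'_v)_{v\in\tau_j}=(h'\cdot a_v)_{v\in\tau_j}$ where $h'W_j$ is admissible for $\tau_j$ and $W_jh'W_j=W_jh_jW_j$. $U_{\mathbf x}$ is the open subscheme of $LG_r(\Gamma)$ parametrizing $(E_v)_v$ such that for every $j\in\mathcal J$ there exists $\mathbf x'\in C_j$ such that for every $v\in\tau_j$ the quotient $L_v/E_v$ (quotient of the base change of $L_v$) is generated by the images of $\{\pi^{-a_v(k)}e_k\mid\mathbf x'_v(k)=a_v(k)\}$; i.e. the intersection over $j$ of the unions over $\mathbf x'\in C_j$ of the corresponding open loci. BRUHAT STRATA. For $a\in\mathbb Z^d$ let $\Lambda(a)=\langle t^{-a(1)}e_1,\dots,t^{-a(d)}e_d\rangle_{\kappa[[t]]}\subset\kappa((t))^d$; identify $\overline L_v$ with $\Lambda(a_v)/t\Lambda(a_v)$ by sending the class of $\pi^{-a_v(k)}e_k$ to that of $t^{-a_v(k)}e_k$. Let $P_j\subset\mathrm{SL}_d(\kappa((t)))$ be the common stabilizer of the $\Lambda(a_v)$, $v\in\tau_j$. $S_{\mathbf x}$ is the set of points $(E_v)_v$ of $LG_r(\Gamma)_0$ such that for each $j$ the tuple $(t^{-1}\widetilde E_v)_{v\in\tau_j}$ lies in the $P_j$-orbit of $(\Lambda(h_j\cdot a_v))_{v\in\tau_j}$, where $\widetilde E_v\subset\Lambda(a_v)$ is the preimage of $E_v\subset\overline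 L_v$. *)

(* Defs.v *)
From HB Require Import structures.
From mathcomp Require Import all_boot all_order all_fingroup all_algebra.
From mathcomp Require Import boolp classical_sets functions cardinality.

Set Implicit Arguments.
Unset Strict Implicit.
Unset Printing Implicit Defensive.

Import GRing.Theory.
Local Open Scope classical_set_scope.
Local Open Scope ring_scope.

(** * The power series ring k[[t]] *)

Record power_series (k : fieldType) := PowerSeries { coefs : nat -> k }.

Section PowerSeries.
Variable k : fieldType.
Local Notation PS := (power_series k).
Implicit Types f g h : PS.

HB.instance Definition _ := gen_eqMixin PS.
HB.instance Definition _ := gen_choiceMixin PS.

Lemma psP f g : coefs f =1 coefs g -> f = g.
Proof. by case: f g => [f] [g] /funext /= ->. Qed.

Definition ps_zero : PS := PowerSeries (fun=> 0).
Definition ps_opp f : PS := PowerSeries (fun n => - coefs f n).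
Definition ps_add f g : PS := PowerSeries (fun n => coefs f n + coefs g n).

Fact ps_addA : associative ps_add.
Proof. by move=> f g h; apply: psP => n /=; rewrite addrA. Qed.
Fact ps_addC : commutative ps_add.
Proof. by move=> f g; apply: psP => n /=; rewrite addrC. Qed.
Fact ps_add0 : left_id ps_zero ps_add.
Proof. by move=> f; apply: psP => n /=; rewrite add0r. Qed.
Fact ps_addN : left_inverse ps_zero ps_opp ps_add.
Proof. by move=> f; apply: psP => n /=; rewrite addNr. Qed.

HB.instance Definition _ :=
  GRing.isZmodule.Build PS ps_addA ps_addC ps_add0 ps_addN.

Definition ps_one : PS := PowerSeries (fun n => (n == 0%N)%:R).
Definition ps_mul f g : PS :=
  PowerSeries (fun n => \sum_(i < n.+1) coefs f i * coefs g (n - i)%N).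

Definition ps_trunc m f : {poly k} := \poly_(i < m) coefs f i.

Fact coef_ps_mul m n f g : (n < m)%N ->
  coefs (ps_mul f g) n = (ps_trunc m f * ps_trunc m g)`_n.
Proof.
move=> ltnm; rewrite coefM; apply: eq_bigr => i _; rewrite !coef_poly.
by rewrite !(leq_ltn_trans _ ltnm) ?leq_subr // -ltnS.
Qed.

Fact ps_mulC : commutative ps_mul.
Proof.
by move=> f g; apply: psP => n; rewrite !(@coef_ps_mul n.+1) // mulrC.
Qed.

Fact ps_mulA : associative ps_mul.
Proof.
move=> f g h; apply: psP => n.
transitivity ((ps_trunc n.+1 f * ps_trunc n.+1 g * ps_trunc n.+1 h)`_n).
  rewrite -mulrA coefM; apply: eq_bigr => i _.
  rewrite (@coef_ps_mul n.+1) ?ltnS ?leq_subr //.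
  by rewrite [in RHS]coef_poly ltn_ord.
rewrite coefM; apply: eq_bigr => i _.
by rewrite (@coef_ps_mul n.+1) // [(ps_trunc _ h)`_ _]coef_poly ltnS leq_subr.
Qed.

Fact ps_mul1 : left_id ps_one ps_mul.
Proof.
move=> f; apply: psP => n /=.
rewrite big_ord_recl /= mul1r subn0 big1 ?addr0 // => i _.
by rewrite mul0r.
Qed.

Fact ps_mulD : left_distributive ps_mul ps_add.
Proof.
move=> f g h; apply: psP => n /=; rewrite -big_split /=.
by apply: eq_bigr => i _; rewrite mulrDl.
Qed.

Fact ps_one_neq0 : ps_one != 0.
Proof.
by apply/eqP => /(congr1 (fun f => coefs f 0)) /= /eqP; rewrite oner_eq0.
Qed.

HB.instance Definition _ :=
  GRing.Zmodule_isComNzRing.Build PS ps_mulA ps_mulC ps_mul1 ps_mulD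
    ps_one_neq0.

Definition ps_unit : pred PS := fun f => `[< exists g, g * f = 1 >].
Definition ps_inv f : PS :=
  if pselect (exists g, g * f = 1) is left ex_g then projT1 (cid ex_g) else f.

Fact ps_mulV : {in ps_unit, left_inverse 1 ps_inv *%R}.
Proof.
move=> f /asboolP ex_g; rewrite /ps_inv; case: pselect => // ex_g'.
exact: projT2 (cid ex_g').
Qed.
Fact ps_unitP f g : g * f = 1 -> ps_unit f.
Proof. by move=> gf1; apply/asboolP; exists g. Qed.
Fact ps_inv_out : {in [predC ps_unit], ps_inv =1 id}.
Proof.
move=> f; rewrite inE /= => /asboolP Nex_g.
by rewrite /ps_inv; case: pselect.
Qed.

HB.instance Definition _ :=
  GRing.ComNzRing_hasMulInverse.Build PS ps_mulV ps_unitP ps_inv_out.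

Fact ps_order f : f != 0 ->
  exists2 n, coefs f n != 0 & forall m, (m < n)%N -> coefs f m = 0.
Proof.
move=> f0; have ex_n : exists n, coefs f n != 0.
  apply: contrapT => Nex; case/eqP: f0; apply: psP => n /=.
  by apply/eqP; apply: contrapT => /negP fn; apply: Nex; exists n.
exists (ex_minn ex_n); case: ex_minnP => // n _ min_n m ltmn.
by apply/eqP/negPn/negP => /min_n; rewrite leqNgt ltmn.
Qed.

Fact ps_integral : GRing.integral_domain_axiom PS.
Proof.
move=> f g fg0; have [_ //|/ps_order[m fm ltm]] := eqVneq f 0.
have [//|/ps_order[n gn ltn]] := eqVneq g 0.
have /(congr1 (fun h => coefs h (m + n)%N)) /= := fg0.
have ltm' : (m < (m + n).+1)%N by rewrite ltnS leq_addr.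
rewrite (bigD1 (Ordinal ltm')) //= addKn big1 ?addr0 => [/eqP|i neq_im].
  by rewrite mulf_eq0 (negPf fm) (negPf gn).
case: (ltngtP i m) => [/ltm ->|ltmi|eq_im]; first by rewrite mul0r.
  rewrite ltn ?mulr0 //.
  have leimn : (i <= m + n)%N by rewrite -ltnS.
  by rewrite ltn_subLR // ltn_add2r.
by case/eqP: neq_im; apply: val_inj.
Qed.

HB.instance Definition _ := GRing.ComUnitRing_isIntegral.Build PS ps_integral.

Definition ps_t : PS := PowerSeries (fun n => (n == 1%N)%:R).
Definition ps_coef0 f : k := coefs f 0.

End PowerSeries.

(** * Discrete valuation rings *)

Definition dvr_uniformizer (R : idomainType) (pi : R) : Prop :=
  [/\ pi != 0, pi \isn't a GRing.unit &
      forall x : R, x != 0 ->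
        exists (u : R) (n : nat), u \is a GRing.unit /\ x = u * pi ^+ n].

(* [red] exhibits [kappa] as R / pi R. *)
Definition residue_map (R : idomainType) (pi : R) (kappa : fieldType)
    (red : {rmorphism R -> kappa}) : Prop :=
  (forall y, exists x, red x = y) /\
  (forall x, red x = 0 <-> exists y, x = y * pi).

(** * Lattices *)

Section Lattices.
Variables (R : idomainType) (d : nat).
Local Notation K := {fraction R}.
Local Notation iota := (@tofrac R).

(* The R-span of the rows of B. *)
Definition row_lattice (B : 'M[K]_d) : set 'rV[K]_d :=
  range (fun x : 'rV[R]_d => map_mx iota x *m B).

Definition lattice (L : set 'rV[K]_d) : Prop :=
  exists2 B : 'M[K]_d, B \in unitmx & L = row_lattice B.

Definition scale (c : K) (L : set 'rV[K]_d) : set 'rV[K]_d :=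
  [set c *: x | x in L].

Definition homothety_class (L : set 'rV[K]_d) : set (set 'rV[K]_d) :=
  [set M | exists2 c : K, c != 0 & M = scale c L].

Definition lattice_class (C : set (set 'rV[K]_d)) : Prop :=
  exists2 L, lattice L & C = homothety_class L.

Definition convex_lattice_configuration
    (Gamma : set (set (set 'rV[K]_d))) : Prop :=
  [/\ finite_set Gamma, Gamma !=set0, Gamma `<=` lattice_class &
      forall C1 C2, Gamma C1 -> Gamma C2 ->
      forall L1 L2, C1 L1 -> C2 L2 -> Gamma (homothety_class (L1 `&` L2))].

Variable pi : R.

Definition adjacent (C1 C2 : set (set 'rV[K]_d)) : Prop :=
  C1 <> C2 /\
  exists L1 L2, [/\ C1 L1, C2 L2, scale (iota pi) L1 `<=` L2 & L2 `<=` L1].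

(* The rows are the vectors pi^(-a(k)) e_k. *)
Definition std_basis (a : 'rV[int]_d) : 'M[K]_d :=
  diag_mx (\row_k iota pi ^ (- a 0 k)).

Definition std_lattice (a : 'rV[int]_d) : set 'rV[K]_d :=
  row_lattice (std_basis a).

Definition standard_apartment : set (set (set 'rV[K]_d)) :=
  [set homothety_class (std_lattice (- c)) | c in setT].

End Lattices.

(** * Modules and open covers over commutative rings

  Submodules of the free module A^d are encoded as sets of row vectors. *)

Section BaseChange.
Variable d : nat.

Definition submodule (A : comNzRingType) (E : set 'rV[A]_d) : Prop :=
  E 0 /\ forall (c : A) x y, E x -> E y -> E (c *: x + y).

(* The B-span of the image of E, i.e. the image of B (x)_A E in B^d. *)
Definition base_change (A B : comNzRingType) (g : {rmorphism A -> B})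
    (E : set 'rV[A]_d) : set 'rV[B]_d :=
  [set y | exists (n : nat) (c : 'I_n -> B) (x : 'I_n -> 'rV[A]_d),
     (forall i, E (x i)) /\ y = \sum_i c i *: map_mx g (x i)].

(* A rank r sub-bundle is locally free with locally free quotient; over an
   affine base this is a direct summand all of whose fibers have dimension r. *)
Definition sub_bundle (r : nat) (A : comNzRingType) (E : set 'rV[A]_d) : Prop :=
  [/\ submodule E,
      exists C : set 'rV[A]_d,
        [/\ submodule C, E `&` C = [set 0] &
            forall z, exists x y, [/\ E x, C y & z = x + y]] &
      forall (F : fieldType) (g : {rmorphism A -> F}),
        exists2 M : 'M[F]_(r, d), row_free M &
          base_change g E = range (fun x : 'rV[F]_r => x *m M)].

(* The quotient A^d / E is generated by the standard basis vectors in Q. *)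
Definition quotient_generated (A : comNzRingType) (E : set 'rV[A]_d)
    (Q : set 'I_d) : Prop :=
  forall z, exists x y : 'rV[A]_d,
    [/\ E x, forall k, y 0 k != 0 -> Q k & z = x + y].

End BaseChange.

Definition unit_ideal (A : comNzRingType) (S : set A) : Prop :=
  exists (n : nat) (c s : 'I_n -> A),
    (forall i, S (s i)) /\ \sum_i c i * s i = 1.

Section OpenCover.
Variables (R : comNzRingType) (d : nat) (I : Type).

(* A subfunctor X of T |-> {families of submodules of O_T^d indexed by I} on
   affine R-schemes T = Spec A. *)
Definition family_functor : Type :=
  forall A : comNzRingType, {rmorphism R -> A} -> set (I -> set 'rV[A]_d).

(* The U_x, for x in D, form an open cover of X: their pullbacks to any
   Spec A -> X are the open subschemes of Spec A complementary to the vanishing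
   loci of subsets S_x of A, and these open subschemes cover Spec A. *)
Definition open_cover (X : family_functor) (T : Type) (D : set T)
    (U : T -> family_functor) : Prop :=
  (forall x, D x -> forall A f, U x A f `<=` X A f) /\
  forall (A : comNzRingType) (f : {rmorphism R -> A}) E, X A f E ->
  exists S : T -> set A,
    (forall x, D x -> forall (B : comNzRingType) (g : {rmorphism A -> B}),
       U x B (g \o f) (fun v => base_change g (E v)) <->
       unit_ideal (g @` S x)) /\
    unit_ideal (\bigcup_(x in D) S x).

End OpenCover.

(** * The extended affine Weyl group, as transformations of Z^d *)

Section Weyl.
Variable d : nat.
Definition transf : Type := 'rV[int]_d -> 'rV[int]_d.

Definition affine_perm (s : 'S_d) (v : 'rV[int]_d) : transf :=
  fun a => \row_k a 0 (s^-1%g k) + v.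

Definition Wtilde : set transf :=
  [set w | exists (s : 'S_d) (v : 'rV[int]_d), w = affine_perm s v].
Definition Waff : set transf :=
  [set w | exists (s : 'S_d) (v : 'rV[int]_d),
    \sum_k v 0 k = 0 /\ w = affine_perm s v].

Definition coset (h : transf) (W : set transf) : set transf :=
  [set h \o w | w in W].
Definition dcoset (W : set transf) (h : transf) : set transf :=
  [set w1 \o h \o w2 | w1 in W & w2 in W].
End Weyl.

(** * The linked Grassmannian, admissible collections and Bruhat strata *)

Section Config.
Variables (R : idomainType) (pi : R) (d : nat) (I : finType).
Variables (a : I -> 'rV[int]_d) (r : nat).
Local Notation K := {fraction R}.

Definition vertex (v : I) : set (set 'rV[K]_d) :=
  homothety_class (std_lattice pi (a v)).

Definition simplex (T : {set I}) : Prop :=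
  forall u v, u \in T -> v \in T -> u != v ->
    adjacent pi (vertex u) (vertex v).

Definition maximal_simplex (T : {set I}) : bool :=
  `[< simplex T /\ forall T' : {set I}, simplex T' -> T \subset T' -> T' = T >].

Definition maxsimplex : Type := {T : {set I} | maximal_simplex T}.

Definition vertex_of (j : maxsimplex) : Type := {v : I | v \in val j}.

(* v0 :: p is the ordering L_0, L_1, ... of the vertices of T. *)
Definition chain_ordered (T : {set I}) : Prop :=
  exists (v0 : I) (p : seq I),
    [/\ perm_eq (v0 :: p) (enum T),
        path (fun u v => `[< std_lattice pi (a u) `<=` std_lattice pi (a v) >])
             v0 p &
        std_lattice pi (a (last v0 p)) `<=`
          scale (tofrac pi)^-1 (std_lattice pi (a v0))].

Definition representatives (Gamma : set (set (set 'rV[K]_d))) : Prop :=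
  [/\ injective vertex, range vertex = Gamma &
      forall j : maxsimplex, chain_ordered (val j)].

(* L_v (x) A is identified with A^d through the basis pi^(-a_v(k)) e_k of L_v.
   In these bases pi^k : L_u -> L_v is right multiplication by M, and the
   existence of such an M with coefficients in R means pi^k L_u is in L_v. *)
Definition LG : family_functor R d I := fun A f =>
  [set E | (forall v, sub_bundle r (E v)) /\
     forall (u v : I) (k : int) (M : 'M[R]_d),
       tofrac pi ^ k *: std_basis pi (a u) =
         map_mx (@tofrac R) M *m std_basis pi (a v) ->
       forall x, E u x -> E v (x *m map_mx f M)].

Definition Wstab (T : {set I}) : set (transf d) :=
  [set w | Waff w /\ forall v, v \in T -> w (a v) = a v].

Definition admissible (h : transf d) (T : {set I}) : Prop :=
  forall v, v \in T ->
    (forall k, a v 0 k <= h (a v) 0 k <= a v 0 k + 1) /\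
    \sum_k h (a v) 0 k - \sum_k a v 0 k = r%:Z.

Definition collection : Type := maxsimplex -> set (transf d).

(* The elements of the coset x j are exactly its representatives h_j. *)
Definition adm : set collection :=
  [set x | (forall j, exists h, [/\ Wtilde h, x j = coset h (Wstab (val j)) &
                                    admissible h (val j)]) /\
     forall j j' h h', x j h -> x j' h' ->
       let W := Wstab (val j :&: val j')%SET in dcoset W h = dcoset W h'].

Definition same_dcoset_tuples (x : collection) (j : maxsimplex) :
    set (vertex_of j -> 'rV[int]_d) :=
  [set x' | exists h h', [/\ x j h, Wtilde h', admissible h' (val j),
     dcoset (Wstab (val j)) h' = dcoset (Wstab (val j)) h &
     x' = fun v => h' (a (val v))]].

(* A morphism Spec A -> LG factors through a union of open subschemes iff each
   field-valued point of Spec A is sent into one of them. *)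
Definition U (x : collection) : family_functor R d I := fun A f =>
  [set E | LG f E /\
     forall (F : fieldType) (g : {rmorphism A -> F}) (j : maxsimplex),
     exists2 x', same_dcoset_tuples x x' &
       forall v : vertex_of j,
         quotient_generated (base_change g (E (val v)))
           [set k | x' v 0 k = a (val v) 0 k]].

Variables (kappa : fieldType) (red : {rmorphism R -> kappa}).
Local Notation Lseries := {fraction power_series kappa}.
Local Notation t := (ps_t kappa).

(* SL_d acts on row vectors from the right; its elements are the same linear
   automorphisms as for column vectors, so the orbits are unchanged. *)
Definition parahoric (T : {set I}) : set 'M[Lseries]_d :=
  [set g | \det g = 1 /\ forall v, v \in T ->
     [set y *m g | y in std_lattice t (a v)] = std_lattice t (a v)].

(* The preimage in Lambda(a_v) of a subspace E of kappa^d = L_v / pi L_v: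
   Lambda(a_v) -> kappa^d takes the constant terms of the coordinates in the
   basis t^(-a_v(k)) e_k. *)
Definition preimage_lattice (v : I) (E : set 'rV[kappa]_d) :
    set 'rV[Lseries]_d :=
  [set map_mx (@tofrac (power_series kappa)) y *m std_basis t (a v)
     | y in [set y | E (map_mx (@ps_coef0 kappa) y)]].

Definition bruhat_stratum (x : collection) : set (I -> set 'rV[kappa]_d) :=
  [set E | LG red E /\
     forall j, exists h g, [/\ x j h, parahoric (val j) g &
       forall v, v \in val j ->
         scale (tofrac t)^-1 (preimage_lattice v (E v)) =
         [set y *m g | y in std_lattice t (h (a v))]]].

End Config.

Arguments adm {R} pi {d I} a r _.
Arguments U {R} pi {d I} a r x {A} f _.
Arguments bruhat_stratum {R} pi {d I} a r {kappa} red x _.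

(* Main.v *)
(* A field-valued point (E_v)_v of LG degenerates, under a generic one-parameter
   subgroup of the torus, to a torus-fixed point: the pivots of E_v for a total
   order on the coordinates, recorded as the vector a_v + 1_{pivots}. Because the
   linked maps are coordinate scalings, these vectors are again linked, and on
   each maximal simplex a counting argument shows that they are the image of
   (a_v)_v under some h_j in the extended affine Weyl group. The h_j agree on
   common vertices, so their cosets form an admissible collection x, and as the
   non-pivot coordinates generate the quotients the point lies in U_x. Openness of
   U_x is the nonvanishing of minors, and nonvanishing at all field-valued points
   means generating the unit ideal.

   For a point of the stratum S_x, take instead an order adapted to the simplex,
   in which the coordinates killed by each linked map come last. The pivots then
   determine the ranks of all linked maps E_u -> L_v. These ranks are invariant
   under the parahoric group, so they are the same for the limit h'_j and for h_j,
   and they determine the double coset W_j h_j W_j. *)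

From HB Require Import structures.
Require Import Defs.
From mathcomp Require Import all_boot all_order all_fingroup all_algebra.
From mathcomp Require Import boolp classical_sets functions cardinality.
From mathcomp Require Import zify.

Set Implicit Arguments.
Unset Strict Implicit.
Unset Printing Implicit Defensive.

Import Order.TTheory GRing.Theory Num.Theory.
Local Open Scope ring_scope.

(** * Matching of alcove-like chains by affine permutations *)

(** In a nested family, the trace on [B] of two sets together is the trace of one of them, so
    cutting [B] by a set or by its complement leaves traces whose sizes are already known. Induction
    on the list counts every membership pattern [q]; the two families must be nested in the same
    direction. *)
Lemma nested_count (T : finType) (X : eqType) (us : seq X) (q : X -> bool)
    (P P' : X -> {set T}) (B B' : {set T}) :
  #|B| = #|B'| ->
  {in us, forall u, #|B :&: P u| = #|B' :&: P' u|} ->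
  {in us &, forall u w,
     B :&: P u \subset P w /\ B' :&: P' u \subset P' w \/
     B :&: P w \subset P u /\ B' :&: P' w \subset P' u} ->
  #|[set k in B | all (fun u => (k \in P u) == q u) us]| =
  #|[set k in B' | all (fun u => (k \in P' u) == q u) us]|.
Proof.
elim: us B B' => [|u us IH] B B' cardB cardP nest.
  by move: cardB; congr (_ = _); apply: eq_card => k; rewrite !inE andbT.
pose cut (D : {set T}) p := if q u then D :&: p else D :\: p.
have cutE (D p : {set T}) k : (k \in cut D p) = (k \in D) && ((k \in p) == q u).
  by rewrite /cut; case: (q u); rewrite !inE; case: (k \in p); rewrite ?andbT ?andbF.
have step (p : X -> {set T}) (D : {set T}) :
    [set k in D | all (fun u => (k \in p u) == q u) (u :: us)] =
    [set k in cut D (p u) | all (fun u => (k \in p u) == q u) us].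
  by apply/setP => k; rewrite !inE cutE /= andbA.
have u_in : u \in u :: us by rewrite mem_head.
have us_in w : w \in us -> w \in u :: us by move=> ?; rewrite inE orbC; apply/orP; left.
rewrite !step; apply: IH.
- rewrite /cut; case: (q u); first exact: cardP.
  by rewrite !finset.cardsD cardB cardP.
- move=> w w_us.
  have cardI : #|(B :&: P u) :&: P w| = #|(B' :&: P' u) :&: P' w|.
    have [[/finset.setIidPl-> /finset.setIidPl->]|[sPw sPw']] := nest u w u_in (us_in w w_us).
      exact: cardP.
    rewrite finset.setIAC [in RHS]finset.setIAC.
    by rewrite (finset.setIidPl sPw) (finset.setIidPl sPw'); apply/cardP/us_in.
  rewrite /cut; case: (q u) => //.
  have splitD (D p p' : {set T}) : (D :\: p) :&: p' = (D :&: p') :\: p.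
    by rewrite finset.setIDAC.
  rewrite !splitD !finset.cardsD cardP ?us_in //; congr (_ - _)%N.
  by rewrite finset.setIAC cardI finset.setIAC.
- have sub_cut (p : X -> {set T}) D : cut D (p u) \subset D.
    by apply/fintype.subsetP => k; rewrite cutE => /andP[].
  move=> v w v_us w_us.
  have [[s s']|[s s']] := nest v w (us_in v v_us) (us_in w w_us); [left|right];
    by split; (apply: fintype.subset_trans; last by [exact: s|exact: s']); apply: finset.setSI.
Qed.

Lemma fiber_perm n (V : eqType) (f f' : 'I_n -> V) :
  (forall v, #|[set k | f k == v]| = #|[set k | f' k == v]|) ->
  exists s : 'S_n, forall k, f' k = f (s k).
Proof.
move=> fib; have /tuple_permP[s sE] : perm_eq [tuple f' k | k < n] [tuple f k | k < n].
  apply/allP => v _ /=; rewrite !count_map.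
  have countE (p : 'I_n -> V) :
      count (preim p (pred1 v)) (enum 'I_n) = #|[set k | p k == v]|.
    rewrite -size_filter cardE /enum_mem -enumT -filter_predI; congr size.
    by apply: eq_filter => k; rewrite /= !inE andbT.
  by rewrite -enumT !countE fib.
exists s => k; have /(congr1 (fun t => nth (f k) t k)) := sE.
by rewrite (nth_map k) ?nth_ord_enum ?size_enum_ord // (nth_map k) ?nth_ord_enum
  ?size_enum_ord // tnth_mktuple.
Qed.

(** In terms of lattices, [L(b)] is contained in [L(c)], and [L(c)] in [pi^-1 L(b)]. *)
Definition between d (b c : 'rV[int]_d) : Prop :=
  forall k, b 0 k <= c 0 k <= b 0 k + 1.

(** The permutation part is read off from the differences with the base point [c0], on which
    translations have no effect; the translation is then forced at [c0]. *)
Lemma affine_match d (X : finType) (c0 : X) (y y' : X -> 'rV[int]_d) :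
  (forall p : X -> int,
     #|[set k | [forall c, y c 0 k - y c0 0 k == p c]]| =
     #|[set k | [forall c, y' c 0 k - y' c0 0 k == p c]]|) ->
  exists s v, forall c, y' c = affine_perm s v (y c).
Proof.
move=> cardE; pose f (z : X -> 'rV[int]_d) k := [ffun c => z c 0 k - z c0 0 k].
have fE z k p : (f z k == p) = [forall c, z c 0 k - z c0 0 k == p c].
  apply/eqP/forallP => [<- c|zp]; first by rewrite ffunE.
  by apply/ffunP => c; rewrite ffunE; apply/eqP.
have [p|s sP] := @fiber_perm d _ (f y) (f y').
  by have := cardE p; congr (_ = _); apply: eq_card => k; rewrite !inE fE.
exists s^-1%g, (\row_k (y' c0 0 k - y c0 0 (s k))) => c; apply/rowP => k.
rewrite !mxE invgK; have /ffunP/(_ c) := sP k; rewrite !ffunE; lia.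
Qed.

(** * Simplices as chains of vectors, and torus-fixed points linked along them *)

Section Chains.
Variables (d : nat) (X : finType) (a : X -> 'rV[int]_d).
Implicit Type x : X -> 'rV[int]_d.

Definition chain : Prop := forall u v, between (a u) (a v) \/ between (a v) (a u).

(** For [x = a + 1_P] these inequalities say that, in the special fiber, the linked maps in both
    directions respect the coordinate subspaces given by [P]. *)
Definition linked x : Prop := forall u v, between (a u) (a v) -> between (x u) (x v).

(** Within a chain, the exponent [n] in {0, 1} of the linked map [pi^n : L_u -> L_v]. *)
Definition turn u v : int := (~~ [forall k, a u 0 k <= a v 0 k])%:Z.

(* On T-fixed points the linked map from [u] to [v] is a coordinate projection;
   for [x = a] this is the set of coordinates on which it is nonzero. *)
Definition kept x u v : {set 'I_d} := [set k | x v 0 k + turn u v == x u 0 k].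

Hypothesis chain_a : chain.

Lemma turn0 u v : between (a u) (a v) -> turn u v = 0.
Proof. by move=> uv; rewrite /turn; case: forallP => // -[] k; case/andP: (uv k). Qed.

Lemma turnP u v :
  (turn u v = 0 /\ between (a u) (a v)) \/ (turn u v = 1 /\ between (a v) (a u)).
Proof.
have [uv|vu] := chain_a u v; first by left; rewrite turn0.
rewrite /turn; case: forallP => /= uv; last by right.
by left; split=> // k; have := vu k; have := uv k; lia.
Qed.

Lemma turn_between x u v k : linked x ->
  x u 0 k <= x v 0 k + turn u v <= x u 0 k + 1.
Proof. by move=> xl; have [[-> /xl/(_ k)]|[-> /xl/(_ k)]] := turnP u v; lia. Qed.

(** Seen from [u], the vectors [x v + turn u v] lie between [x u] and [x u + 1] and are totally
    ordered, and [kept] shrinks as they grow. Their order comes from [a] alone, so one direction of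
    nesting serves every linked [x]. *)
Lemma kept_nested u v w :
  (forall x, linked x -> kept x u v \subset kept x u w) \/
  (forall x, linked x -> kept x u w \subset kept x u v).
Proof.
have nest v' w' : (forall x k, linked x ->
    x v' 0 k + turn u v' <= x w' 0 k + turn u w') ->
    forall x, linked x -> kept x u w' \subset kept x u v'.
  move=> vw x xl; apply/fintype.subsetP => k; rewrite !inE.
  by have := vw x k xl; have := turn_between u v' k xl; lia.
have [[v0 uv]|[v1 vu]] := turnP u v; have [[w0 uw]|[w1 wu]] := turnP u w;
  have [vw|wv] := chain_a v w.
- by right; apply: nest => x k xl; have := xl _ _ vw k; lia.
- by left; apply: nest => x k xl; have := xl _ _ wv k; lia.
- suff /turn0 : between (a u) (a w) by lia.
  by move=> k; have := uv k; have := vw k; have := wu k; lia.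
- by right; apply: nest => x k xl; have := xl _ _ wv k; lia.
- by left; apply: nest => x k xl; have := xl _ _ vw k; lia.
- suff /turn0 : between (a u) (a v) by lia.
  by move=> k; have := uw k; have := wv k; have := vu k; lia.
- by right; apply: nest => x k xl; have := xl _ _ vw k; lia.
- by left; apply: nest => x k xl; have := xl _ _ wv k; lia.
Qed.

(** Each summand is the indicator of a coordinate that is not kept, so the cardinality sees [x] only
    through its coordinate sums. *)
Lemma card_kept x u v : linked x ->
  #|kept x u v|%:Z = d%:Z - \sum_k (x v 0 k - x u 0 k + turn u v).
Proof.
move=> xl; have -> : d%:Z = \sum_(k < d) 1 by rewrite sumr_const card_ord -natz.
rewrite -sumrB -sum1_card (big_morph Posz PoszD erefl) big_mkcond /=.
apply: eq_bigr => k _; rewrite inE; have := turn_between u v k xl.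
by case: eqP; lia.
Qed.

(** A difference shifted by the turn is 0 or 1, so a profile of differences is a pattern of
    memberships in the sets [kept]. *)
Lemma profile_kept x u k (p : X -> int) : linked x ->
  [forall c, x c 0 k - x u 0 k == p c] =
  [forall c, 0 <= p c + turn u c <= 1] &&
    all (fun c => (k \in kept x u c) == (p c + turn u c == 0)) (enum X).
Proof.
move=> xl; apply/forallP/andP => [xp|[/forallP p01 /allP xp] c].
  split; [apply/forallP => c|apply/allP => c _]; have /eqP := xp c;
    have := turn_between u c k xl; rewrite ?inE; lia.
have := p01 c; have := xp c (mem_enum _ _); have := turn_between u c k xl.
by rewrite inE; lia.
Qed.

(** Seen from [c0], the kept sets of [x] and of [a] are nested alike and, by the equality of sums,
    equinumerous; nested counting then matches all profiles of differences. *)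
Lemma chain_affine x (c0 : X) : linked x ->
  (forall u v, \sum_k (x v 0 k - x u 0 k) = \sum_k (a v 0 k - a u 0 k)) ->
  exists s v, forall c, x c = affine_perm s v (a c).
Proof.
move=> xl sumE; have al : linked a by [].
apply: (@affine_match d X c0 a x) => p.
under eq_finset do rewrite (profile_kept _ _ _ al).
under [in RHS]eq_finset do rewrite (profile_kept _ _ _ xl).
case: forallP => _; last by rewrite !cards0.
have setTE (D : pred 'I_d) : #|[set k | true && D k]| = #|[set k in finset.setT | D k]|.
  by apply: eq_card => k; rewrite !inE.
rewrite [LHS]setTE [RHS]setTE; apply: nested_count => // [u _|u v _ _].
  rewrite !finset.setTI; apply/eqP; rewrite -eqz_nat !card_kept //.
  have split_sum (y : X -> 'rV[int]_d) : \sum_k (y u 0 k - y c0 0 k + turn c0 u) =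
      \sum_k (y u 0 k - y c0 0 k) + \sum_(k < d) turn c0 u by rewrite big_split.
  by rewrite !split_sum sumE.
rewrite !finset.setTI; have [nest|nest] := kept_nested c0 u v; [left|right];
  by split; apply: nest.
Qed.

(** Meant for comparing double cosets, which needs a single affine permutation for [a] and [x]
    together. Counting within the kept sets suffices, by nested counting applied twice. *)
Lemma chain_matching x x' (c0 : X) : linked x -> linked x' ->
  (forall u, between (a u) (x u)) -> (forall u, between (a u) (x' u)) ->
  (forall u v, #|[set k in kept a u v | x u 0 k == a u 0 k + 1]| =
               #|[set k in kept a u v | x' u 0 k == a u 0 k + 1]|) ->
  exists s v, forall c, affine_perm s v (a c) = a c /\
    affine_perm s v (x c) = x' c.
Proof.
move=> xl xl' ax ax' cardE; have al : linked a by [].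
(* Listing [a] and [x] in one doubled family forces a common permutation and translation. *)
pose y (z : X -> 'rV[int]_d) (c : X + X) := match c with inl c => a c | inr c => z c end.
suff [s [v svP]] : exists s v, forall c, y x' c = affine_perm s v (y x c).
  by exists s, v => c; have /= <- := svP (inl c); have /= <- := svP (inr c).
apply: (@affine_match d _ (inl c0) (y x) (y x')) => p.
pose B := [set k | [forall c, a c 0 k - a c0 0 k == p (inl c)]].
pose Pi (z : X -> 'rV[int]_d) u := [set k | z u 0 k == a u 0 k + 1].
have profE z : (forall u, between (a u) (z u)) ->
    [set k | [forall c, y z c 0 k - y z (inl c0) 0 k == p c]] =
    if [forall c, 0 <= p (inr c) - p (inl c) <= 1] then
      [set k in B | all (fun c => (k \in Pi z c) == (p (inr c) - p (inl c) == 1)) (enum X)]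
    else finset.set0.
  move=> az; apply/setP => k; rewrite inE; apply/forallP/idP => [zp|].
    case: forallP => p01.
      rewrite !inE; apply/andP; split.
        by apply/forallP => c; exact: zp (inl c).
      apply/allP => c _; rewrite inE; have /eqP /= := zp (inl c).
      by have /eqP /= := zp (inr c); have := az c k; lia.
    case: p01 => c; have /eqP /= := zp (inl c).
    by have /eqP /= := zp (inr c); have := az c k; lia.
  case: forallP => [p01|_]; last by rewrite inE.
  rewrite !inE => /andP[/forallP ap /allP zp] [c|c] //=.
  have := zp c (mem_enum _ _); rewrite inE.
  by have /eqP := ap c; have := p01 c; have := az c k; lia.
rewrite !profE //; case: ifP => // _.
have [->|[k0 k0B]] := finset.set_0Vmem B; first by rewrite !finset.setIdE !finset.set0I.
(* The profile of [a] cut out by [B] can be described from any vertex [u], not only from [c0]; this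
   brings in the hypothesis on the pairs [u], [v]. *)
have BE u k : (k \in B) =
    all (fun v => (k \in kept a u v) == (k0 \in kept a u v)) (enum X).
  move: k0B; rewrite !inE => /forallP k0B.
  apply/forallP/allP => [kB v _|kB c].
    by rewrite !inE; have := kB v; have := kB u; have := k0B v; have := k0B u; lia.
  have keep v := kB v (mem_enum _ _).
  have := keep c; have := keep c0; rewrite !inE.
  have := turn_between u c k al; have := turn_between u c0 k al.
  have := turn_between u c k0 al; have := turn_between u c0 k0 al.
  by have := k0B c; lia.
apply: nested_count => // [u _|u v _ _].
  rewrite ![B :&: _]finset.setIC.
  have BPi z : Pi z u :&: B =
      [set k in Pi z u | all (fun v => (k \in kept a u v) == (k0 \in kept a u v)) (enum X)].
    by apply/setP => k; rewrite !inE -BE inE.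
  rewrite !BPi; apply: nested_count.
  - have := cardE u u; congr (_ = _); apply: eq_card => k; rewrite !inE /turn;
      by case: forallP => [|[]//]; rewrite addr0 eqxx.
  - move=> v _; have := cardE u v; congr (_ = _); apply: eq_card => k;
      by rewrite !inE andbC.
  - move=> v w _ _; have [nest|nest] := kept_nested u v w; [left|right];
      by split; apply: (fintype.subset_trans (finset.subsetIr _ _)); apply: nest.
(* On [B] the difference [a v - a u] is constant. When [a u <= a v], the trace of [Pi u] lies in
   [Pi v] if it is 0, and the inclusion is reversed if it is 1. *)
have Bdiff k : k \in B -> a v 0 k - a u 0 k = p (inl v) - p (inl u).
  by rewrite inE => /forallP kB; rewrite -(eqP (kB u)) -(eqP (kB v)) opprB addrA subrK.
have nest u' v' : (forall z k, linked z -> k \in B ->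
      z u' 0 k - a u' 0 k <= z v' 0 k - a v' 0 k) ->
    forall z, linked z -> between (a v') (z v') -> B :&: Pi z u' \subset Pi z v'.
  move=> uv z zl az; apply/fintype.subsetP => k; rewrite inE => /andP[kB].
  by rewrite !inE; have := uv z k zl kB; have := az k; lia.
have [uv|vu] := chain_a u v.
  have [p_eq|p_neq] := eqVneq (p (inl v)) (p (inl u)); [left|right];
    split; apply: nest => // z k zl kB; have := Bdiff k kB; have := uv k; have := zl _ _ uv k; lia.
have [p_eq|p_neq] := eqVneq (p (inl v)) (p (inl u)); [right|left];
  split; apply: nest => // z k zl kB; have := Bdiff k kB; have := vu k; have := zl _ _ vu k; lia.
Qed.

End Chains.

Local Open Scope classical_set_scope.
Local Open Scope ring_scope.

(** * Field-valued points and open sets *)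

Section MaximalIdeals.
Variable A : comNzRingType.
Implicit Type S : set A.

Definition ideal_set S : Prop :=
  S 0 /\ forall c x y, S x -> S y -> S (c * x + y).

Definition ideal_span S : set A :=
  [set z | exists (n : nat) (c s : 'I_n -> A),
     (forall i, S (s i)) /\ z = \sum_i c i * s i].

Lemma sub_ideal_span S : S `<=` ideal_span S.
Proof.
move=> s Ss; exists 1%N, (fun=> 1), (fun=> s); split=> //.
by rewrite big_ord1 mul1r.
Qed.

Lemma ideal_span_ideal S : ideal_set (ideal_span S).
Proof.
split; first by exists 0%N, (fun=> 0), (fun=> 0); split=> [[]//|]; rewrite big_ord0.
move=> e _ _ [m [c [s [Ss ->]]]] [n [c' [s' [Ss' ->]]]].
exists (m + n)%N, (fun i => match fintype.split i with inl j => e * c j | inr j => c' j end),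
  (fun i => match fintype.split i with inl j => s j | inr j => s' j end).
split=> [i|]; first by case: fintype.splitP.
rewrite big_split_ord /= mulr_sumr; congr (_ + _); apply: eq_bigr => i _.
  by rewrite -/(unsplit (inl i)) unsplitK mulrA.
by rewrite -/(unsplit (inr i)) unsplitK.
Qed.

Lemma maximal_ideal S : ~ ideal_span S 1 ->
  exists J, [/\ ideal_set J, ~ J 1, S `<=` J &
    forall J', ideal_set J' -> J `<=` J' -> ~ J' 1 -> J' `<=` J].
Proof.
(* Adjoining [ideal_span S] makes [P] hold for the union of the empty chain, which is empty. *)
move=> S1; pose P J := ideal_set (ideal_span S `|` J) /\ ~ (ideal_span S `|` J) 1.
have S0 : ideal_span S 0 by case: (ideal_span_ideal S).
have PF (F : set (set A)) :
    F `<=` P -> total_on F subset -> P (\bigcup_(X in F) X).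
  move=> FP Ftot; split; last first.
    by case=> // -[X FX X1]; case: (FP X FX) => _; apply; right.
  split=> [|c x y]; first by left.
  have two X x' y' : F X -> (ideal_span S `|` X) x' -> (ideal_span S `|` X) y' ->
      (ideal_span S `|` \bigcup_(X in F) X) (c * x' + y').
    move=> FX Xx Xy; have [[_ XD] _] := FP X FX.
    by case: (XD c _ _ Xx Xy) => ?; [left|right; exists X].
  case=> [Sx|[X FX Xx]] [Sy|[Y FY Yy]].
  - by left; have [_] := ideal_span_ideal S; apply.
  - by apply: (two Y) => //; [left|right].
  - by apply: (two X) => //; [right|left].
  - have [XY|YX] := Ftot X Y FX FY.
      by apply: (two Y) => //; right=> //; apply: XY.
    by apply: (two X) => //; right=> //; apply: YX.
have [J [[JI J1] Jmax]] := Zorn_bigcup PF.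
exists (ideal_span S `|` J); split=> // [s Ss|J' J'I JJ' J'1].
  by left; exact: sub_ideal_span.
have eqJ' : ideal_span S `|` J' = J'.
  by apply/seteqP; split=> [x []|x] //; [move=> ?; apply: JJ'; left|right].
move=> x J'x; apply: contrapT => Jx; apply: (Jmax J'); last by rewrite /P eqJ'.
split=> [y Jy|J'J]; first by apply: JJ'; right.
by apply: Jx; right; exact: J'J.
Qed.

End MaximalIdeals.

Lemma quotient_field_map (A : comNzRingType) (J : set A) :
  ideal_set J -> ~ J 1 ->
  (forall J', ideal_set J' -> J `<=` J' -> ~ J' 1 -> J' `<=` J) ->
  exists (F : fieldType) (g : {rmorphism A -> F}), forall x, J x -> g x = 0.
Proof.
move=> [J0 JD] J1 Jmax; pose S : A -> bool := fun x => `[< J x >].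
have Sclosed : idealr_closed S.
  split; [exact/asboolP|by apply/negP => /asboolP|].
  by move=> c x y /asboolP Jx /asboolP Jy; apply/asboolP; exact: JD.
pose I : idealr A := HB.pack S (isIdealr.Build A S Sclosed).
pose Q : comNzRingType := {ideal_quot I}.
pose p : {rmorphism A -> Q} := \pi_Q%qT.
have pE x : (p x == 0) = S x.
  have -> : 0 = p 0 by rewrite rmorph0.
  by rewrite /p -Quotient.idealrBE subr0.
have p_surj (q : Q) : exists x, p x = q by exists (generic_quotient.repr q); exact: reprK.
have ex_inv (q : Q) : exists q' : Q, (q != 0 -> q' * q = 1) /\ (q = 0 -> q' = 0).
  have [->|q0] := eqVneq q 0; first by exists 0.
  have [x xq] := p_surj q.
  pose J' : set A := [set z | exists c y, J y /\ z = c * x + y].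
  have J'I : ideal_set J'.
    split; first by exists 0, 0; rewrite mul0r addr0.
    move=> e _ _ [c [y [Jy ->]]] [c' [y' [Jy' ->]]].
    exists (e * c + c'), (e * y + y'); split; first exact: JD.
    by rewrite mulrDl mulrDr !mulrA addrACA.
  have JJ' : J `<=` J' by move=> y Jy; exists 0, y; rewrite mul0r add0r.
  have J'1 : J' 1.
    apply: contrapT => /(Jmax J' J'I JJ') J'J.
    have : J x by apply: J'J; exists 1, 0; rewrite mul1r addr0.
    by move=> /asboolP; rewrite -/(S x) -pE xq (negPf q0).
  have [c [y [Jy xy1]]] := J'1; exists (p c); split=> [_|/eqP]; last by rewrite (negPf q0).
  have /eqP py : p y == 0 by rewrite pE; exact/asboolP.
  by rewrite -(rmorph1 p) xy1 rmorphD rmorphM /= py addr0 xq.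
have [inv invP] := choice ex_inv.
pose F : fieldType := HB.pack (GRing.ComNzRing.sort Q)
  (GRing.ComNzRing_isField.Build Q (fun x => (invP x).1) ((invP 0).2 erefl)).
by exists F, p => x Jx; apply/eqP; rewrite pE; exact/asboolP.
Qed.

(** A set generating a proper ideal lies in a maximal ideal, and the residue field there is a point
    at which all its members vanish. *)
Lemma unit_idealP (A : comNzRingType) (S : set A) :
  unit_ideal S <->
  forall (F : fieldType) (g : {rmorphism A -> F}),
    exists2 s, S s & g s != 0.
Proof.
split=> [[n [c [s [Ss cs1]]]] F g|ptS].
  apply: contrapT => noS; have /eqP := oner_neq0 F; apply.
  rewrite -(rmorph1 g) -cs1 rmorph_sum big1 // => i _; rewrite rmorphM /=.
  have [->|gs] := eqVneq (g (s i)) 0; first by rewrite mulr0.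
  by case: noS; exists (s i).
have [[n [c [s [Ss /esym cs1]]]]|S1] := pselect (ideal_span S 1).
  by exists n, c, s.
have [J [JI J1 SJ Jmax]] := maximal_ideal S1.
have [F [g gJ]] := quotient_field_map JI J1 Jmax.
by have [s /SJ/gJ -> /eqP] := ptS F g.
Qed.

(** Openness of a locus known only through its field-valued points: around each of them it contains
    the principal open set of some [s]. *)
Definition open_points (A : comNzRingType)
    (Phi : forall F : fieldType, {rmorphism A -> F} -> Prop) : Prop :=
  forall (F : fieldType) (g : {rmorphism A -> F}), Phi F g ->
    exists2 s, g s != 0 &
      forall (F' : fieldType) (g' : {rmorphism A -> F'}), g' s != 0 -> Phi F' g'.

Lemma open_points_exists (A : comNzRingType) (T : Type) (D : set T)
    (Phi : T -> forall F : fieldType, {rmorphism A -> F} -> Prop) :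
  (forall x, D x -> open_points (Phi x)) ->
  open_points (fun F g => exists2 x, D x & Phi x F g).
Proof.
move=> openPhi F g [x Dx /(openPhi x Dx)[s gs sP]]; exists s => // F' g' g's.
by exists x => //; exact: sP.
Qed.

Lemma open_points_forall (A : comNzRingType) (T : finType)
    (Phi : T -> forall F : fieldType, {rmorphism A -> F} -> Prop) :
  (forall x, open_points (Phi x)) ->
  open_points (fun F g => forall x, Phi x F g).
Proof.
move=> openPhi F g gPhi.
have /choice[s sP] : forall x, exists s, g s != 0 /\
    forall (F' : fieldType) (g' : {rmorphism A -> F'}), g' s != 0 -> Phi x F' g'.
  by move=> x; have [s gs sP] := openPhi x F g (gPhi x); exists s.
exists (\prod_x s x) => [|F' g'].
  by rewrite rmorph_prod; apply/prodf_neq0 => x _; case: (sP x).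
rewrite rmorph_prod => /prodf_neq0 g's x.
by case: (sP x) => _; apply; exact: g's.
Qed.

(** * Direct summands and base change *)

Section Projectors.
Variable d : nat.

Lemma submodule_sum (A : comNzRingType) (E : set 'rV[A]_d) (J : finType)
    (c : J -> A) (x : J -> 'rV[A]_d) :
  submodule E -> (forall i, E (x i)) -> E (\sum_i c i *: x i).
Proof.
move=> [E0 ED] Ex; elim/big_ind: _ => // [y z Ey Ez|i _].
  by rewrite -[y]scale1r; exact: ED.
by rewrite -[_ *: _]addr0; apply: ED.
Qed.

(** An idempotent matrix with row space [E]; it carries a direct summand through base change. *)
Definition projector (A : comNzRingType) (E : set 'rV[A]_d) (P : 'M[A]_d) : Prop :=
  (forall x, E (x *m P)) /\ forall x, E x -> x *m P = x.

Lemma projector_range (A : comNzRingType) (E : set 'rV[A]_d) (P : 'M[A]_d) :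
  projector E P -> E = range (fun x : 'rV_d => x *m P).
Proof.
move=> [EP PE]; apply/seteqP; split=> [x Ex|_ [x _ <-] //].
by exists x; rewrite ?PE.
Qed.

Lemma projector_submodule (A : comNzRingType) (E : set 'rV[A]_d) (P : 'M[A]_d) :
  projector E P -> submodule E.
Proof.
move=> /projector_range ->; split; first by exists 0; rewrite ?mul0mx.
move=> c _ _ [x _ <-] [y _ <-]; exists (c *: x + y) => //.
by rewrite mulmxDl scalemxAl.
Qed.

Lemma summand_projector (A : comNzRingType) (E C : set 'rV[A]_d) :
  submodule E -> submodule C -> E `&` C = [set 0] ->
  (forall z, exists x y, [/\ E x, C y & z = x + y]) ->
  exists P, projector E P /\ projector C (1%:M - P).
Proof.
move=> Esub Csub EC0 EC.
have /choice[x xP] : forall k : 'I_d, exists x, E x /\ C (delta_mx 0 k - x).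
  move=> k; have [x [y [Ex Cy ->]]] := EC (delta_mx 0 k).
  by exists x; rewrite addrC addKr.
pose P := \matrix_k x k.
have mulP z : z *m P = \sum_k z 0 k *: x k.
  by rewrite mulmx_sum_row; apply: eq_bigr => k _; rewrite rowK.
have EP z : E (z *m P).
  by rewrite mulP; apply: submodule_sum => // k; case: (xP k).
have CP z : C (z *m (1%:M - P)).
  rewrite mulmxBr mulmx1 mulP {1}[z]row_sum_delta -sumrB.
  under eq_bigr do rewrite -scalerBr.
  by apply: submodule_sum => // k; case: (xP k).
have [E0 ED] := Esub; have [C0 CD] := Csub.
have EB u v : E u -> E v -> E (u - v).
  by move=> Eu Ev; rewrite addrC -scaleN1r; exact: ED.
have CB u v : C u -> C v -> C (u - v).
  by move=> Cu Cv; rewrite addrC -scaleN1r; exact: CD.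
have eq0 u : E u -> C u -> u = 0.
  by move=> Eu Cu; have : (E `&` C) u by []; rewrite EC0.
exists P; split; split=> // z zin.
- apply/eqP; rewrite eq_sym -subr_eq0; apply/eqP/eq0; first exact: EB.
  by rewrite -{1}[z]mulmx1 -mulmxBr.
- rewrite mulmxBr mulmx1; suff -> : z *m P = 0 by rewrite subr0.
  apply: eq0 => //; have -> : z *m P = z - z *m (1%:M - P).
    by rewrite mulmxBr mulmx1 opprB addrC subrK.
  exact: CB.
Qed.

Lemma projector_base_change (A B : comNzRingType) (g : {rmorphism A -> B})
    (E : set 'rV[A]_d) (P : 'M[A]_d) :
  projector E P -> projector (base_change g E) (map_mx g P).
Proof.
move=> [EP PE]; split=> [x|_ [n [c [x [Ex ->]]]]].
  exists d, (fun k => x 0 k), (fun k => row k P); split=> [k|].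
    by rewrite rowE.
  by rewrite mulmx_sum_row; apply: eq_bigr => k _; rewrite map_row.
rewrite mulmx_suml; apply: eq_bigr => i _.
by rewrite -scalemxAl -map_mxM PE.
Qed.

Lemma base_change_comp (A B C : comNzRingType) (g : {rmorphism A -> B})
    (h : {rmorphism B -> C}) (E : set 'rV[A]_d) (P : 'M[A]_d) :
  projector E P ->
  base_change h (base_change g E) = base_change (h \o g) E.
Proof.
move=> EP; have /projector_range -> := projector_base_change (h \o g) EP.
have /(projector_base_change h)/projector_range -> := projector_base_change g EP.
by rewrite (map_mx_comp g h).
Qed.

Lemma base_change_id (A : comNzRingType) (E : set 'rV[A]_d) :
  submodule E -> base_change idfun E = E.
Proof.
move=> Esub; apply/seteqP; split=> [_ [n [c [x [Ex ->]]]]|x Ex].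
  under eq_bigr do rewrite map_mx_id //.
  exact: submodule_sum.
exists 1%N, (fun=> 1), (fun=> x); split=> //.
by rewrite big_ord1 scale1r map_mx_id.
Qed.

Lemma sub_bundle_projector r (A : comNzRingType) (E : set 'rV[A]_d) :
  sub_bundle r E -> exists P, projector E P.
Proof.
move=> [Esub [C [Csub EC0 EC]] _].
by have [P []] := summand_projector Esub Csub EC0 EC; exists P.
Qed.

Lemma sub_bundle_base_change r (A B : comNzRingType) (g : {rmorphism A -> B})
    (E : set 'rV[A]_d) :
  sub_bundle r E -> sub_bundle r (base_change g E).
Proof.
move=> Ebun; have [Esub [C [Csub EC0 EC]] Erk] := Ebun.
have [P [EP CP]] := summand_projector Esub Csub EC0 EC.
have EP' := projector_base_change g EP; have CP' := projector_base_change g CP.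
have gP1 : map_mx g (1%:M - P) = 1%:M - map_mx g P.
  by rewrite map_mxB map_scalar_mx rmorph1.
split; first exact: projector_submodule EP'.
  exists (base_change g C); split; first exact: projector_submodule CP'.
    apply/seteqP; split=> [x [/EP'.2 xP /CP'.2]|_ ->]; last first.
      by split; [case: (projector_submodule EP')|case: (projector_submodule CP')].
    by rewrite gP1 mulmxBr mulmx1 xP subrr.
  move=> z; exists (z *m map_mx g P), (z *m map_mx g (1%:M - P)).
  split; [exact: EP'.1|exact: CP'.1|].
  by rewrite gP1 mulmxBr mulmx1 addrC subrK.
move=> F h; have [M Mfree ME] := Erk F (h \o g).
by exists M; rewrite // (base_change_comp _ _ EP) ME.
Qed.

Lemma base_change_linked (A B : comNzRingType) (g : {rmorphism A -> B})
    (E E' : set 'rV[A]_d) (M : 'M[A]_d) (P : 'M[A]_d) :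
  projector E' P ->
  (forall x, E x -> E' (x *m M)) ->
  forall x, base_change g E x -> base_change g E' (x *m map_mx g M).
Proof.
move=> E'P EE' _ [n [c [x [Ex ->]]]].
have E'sub := projector_submodule (projector_base_change g E'P).
rewrite mulmx_suml; under eq_bigr do rewrite -scalemxAl -map_mxM.
apply: submodule_sum => // i.
exists 1%N, (fun=> 1), (fun=> x i *m M); split; first by move=> _; exact: EE'.
by rewrite big_ord1 scale1r.
Qed.

Lemma sub_bundle_rank r (F : fieldType) (E : set 'rV[F]_d) :
  sub_bundle r E -> exists2 M : 'M[F]_(r, d), row_free M &
    E = range (fun x : 'rV[F]_r => x *m M).
Proof.
move=> [Esub _ Erk]; have [M Mfree ME] := Erk F idfun.
by exists M => //; rewrite -ME base_change_id.
Qed.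

Definition coord_mx (A : comNzRingType) (Q : pred 'I_d) : 'M[A]_d :=
  diag_mx (\row_k (Q k)%:R).

Lemma map_coord_mx (A B : comNzRingType) (g : {rmorphism A -> B}) Q :
  map_mx g (coord_mx A Q) = coord_mx B Q.
Proof.
by rewrite map_diag_mx; congr diag_mx; apply/rowP => k; rewrite !mxE rmorph_nat.
Qed.

Lemma mul_coord_mx (A : comNzRingType) Q (x : 'rV[A]_d) k :
  (x *m coord_mx A Q) 0 k = if Q k then x 0 k else 0.
Proof. by rewrite mul_mx_diag !mxE; case: (Q k); rewrite ?mulr1 ?mulr0. Qed.

(** Generation becomes a full-rank condition on one matrix, hence the nonvanishing of a minor. *)
Lemma quotient_generatedP (F : fieldType) (E : set 'rV[F]_d) (P : 'M[F]_d)
    (Q : set 'I_d) :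
  projector E P ->
  quotient_generated E Q <-> row_full (col_mx P (coord_mx F (fun k => `[< Q k >]))).
Proof.
move=> EP; rewrite -sub1mx; split=> [EQ|/row_subP full z].
  apply/row_subP => k; rewrite row1.
  have [x [y [Ex Qy ->]]] := EQ (delta_mx 0 k).
  apply: addmx_sub.
    rewrite -(EP.2 x Ex) -addsmxE; apply: submx_trans (addsmxSl _ _).
    exact: submxMl.
  rewrite -addsmxE; apply: submx_trans (addsmxSr _ _).
  suff -> : y = y *m coord_mx F (fun k => `[< Q k >]) by exact: submxMl.
  apply/rowP => l; rewrite mul_coord_mx; case: asboolP => // NQ.
  by apply: contrapT => /eqP/Qy.
have /submxP[u zu] : (z <= col_mx P (coord_mx F (fun k => `[< Q k >])))%MS.
  by apply: submx_trans (submx1 _) _; apply/row_subP.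
exists (lsubmx u *m P), (rsubmx u *m coord_mx F (fun k => `[< Q k >])).
split; first exact: EP.1.
  by move=> k; rewrite mul_coord_mx; case: asboolP => // _; rewrite eqxx.
by rewrite zu -{1}[u]hsubmxK mul_row_col.
Qed.

Lemma open_quotient_generated (A : comNzRingType) (E : set 'rV[A]_d)
    (P : 'M[A]_d) (Q : set 'I_d) :
  projector E P ->
  open_points (fun F (g : {rmorphism A -> F}) => quotient_generated (base_change g E) Q).
Proof.
move=> EP F g; pose N := col_mx P (coord_mx A (fun k => `[< Q k >])).
have mapN (F' : fieldType) (g' : {rmorphism A -> F'}) :
    col_mx (map_mx g' P) (coord_mx F' (fun k => `[< Q k >])) = map_mx g' N.
  by rewrite map_col_mx map_coord_mx.
move=> /(quotient_generatedP _ (projector_base_change g EP)); rewrite mapN => full.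
(* The rows are selected at the given point, but the minor is formed over [A], so it is a function
   on the whole base. *)
exists (\det (rowsub (fullrankfun full) N)).
  rewrite -det_map_mx map_mxsub -unitfE -unitmxE; exact: fullrowsub_unit.
move=> F' g'; rewrite -det_map_mx map_mxsub -unitfE -unitmxE => unit_sub.
apply/(quotient_generatedP _ (projector_base_change g' EP)); rewrite mapN.
rewrite -sub1mx -(mulVmx unit_sub); apply: mulmx_sub.
exact: rowsub_sub.
Qed.

Lemma quotient_generated_base_change (A B : comNzRingType) (g : {rmorphism A -> B})
    (E : set 'rV[A]_d) (Q : set 'I_d) :
  submodule (base_change g E) ->
  quotient_generated E Q -> quotient_generated (base_change g E) Q.
Proof.
move=> Esub EQ z.
have /choice[x xP] : forall k : 'I_d, exists x, E x /\
    forall l, (delta_mx 0 k - x) 0 l != 0 -> Q l.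
  move=> k; have [x [y [Ex Cy ->]]] := EQ (delta_mx 0 k).
  by exists x; rewrite addrC addKr.
exists (\sum_k z 0 k *: map_mx g (x k)),
  (\sum_k z 0 k *: map_mx g (delta_mx 0 k - x k)); split.
- apply: submodule_sum => // k; exists 1%N, (fun=> 1), (fun=> x k).
  by split=> [_|]; [case: (xP k)|rewrite big_ord1 scale1r].
- move=> l; rewrite summxE => nz; apply: contrapT => NQ; case/eqP: nz.
  apply: big1 => k _; rewrite mxE mxE; have [_ /(_ l)] := xP k.
  by have [->|_ /(_ isT)] := eqVneq; rewrite ?rmorph0 ?mulr0.
- rewrite -big_split /= {1}[z]row_sum_delta; apply: eq_bigr => k _.
  by rewrite -scalerDr -map_mxD addrC subrK map_delta_mx.
Qed.

End Projectors.

Lemma LG_base_change (R : idomainType) (pi : R) d (I : finType)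
    (a : I -> 'rV[int]_d) r (A B : comNzRingType) (f : {rmorphism R -> A})
    (g : {rmorphism A -> B}) E :
  LG pi a r f E -> LG pi a r (g \o f) (fun v => base_change g (E v)).
Proof.
move=> [Ebun Elink]; split=> [v|u v k M MP x Ex].
  exact: sub_bundle_base_change.
have [P EP] := sub_bundle_projector (Ebun v).
rewrite map_mx_comp; apply: (base_change_linked EP _ Ex).
exact: Elink MP.
Qed.

(** * Double cosets in the extended affine Weyl group *)

Section WeylGroup.
Variable d : nat.
Implicit Types h w : transf d.

Lemma affine_permE (s : 'S_d) v b k : affine_perm s v b 0 k = b 0 (s^-1%g k) + v 0 k.
Proof. by rewrite !mxE. Qed.

Lemma affine_perm_comp (s s' : 'S_d) v v' :
  affine_perm s v \o affine_perm s' v' =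
  affine_perm (s' * s) (\row_k (v' 0 (s^-1%g k) + v 0 k)).
Proof.
apply: funext => b; apply/rowP => k.
by rewrite /= !affine_permE invMg permM mxE addrA.
Qed.

Lemma affine_perm_id : affine_perm 1 0 = id :> transf d.
Proof.
by apply: funext => b; apply/rowP => k; rewrite affine_permE invg1 perm1 mxE addr0.
Qed.

Lemma sum_affine_perm (s : 'S_d) v b :
  \sum_k affine_perm s v b 0 k = \sum_k b 0 k + \sum_k v 0 k.
Proof.
under eq_bigr do rewrite affine_permE.
rewrite big_split /=; congr (_ + _).
by rewrite [RHS](reindex_inj (@perm_inj _ s^-1%g)).
Qed.

Lemma Wtilde_inverse h : Wtilde h -> exists h', [/\ Wtilde h', h \o h' = id & h' \o h = id].
Proof.
move=> [s [v ->]]; exists (affine_perm s^-1 (\row_k - v 0 (s k))).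
split; first by do 2 eexists.
  rewrite affine_perm_comp mulVg -[RHS]affine_perm_id; congr affine_perm.
  by apply/rowP => k; rewrite !mxE permKV addNr.
rewrite affine_perm_comp mulgV -[RHS]affine_perm_id; congr affine_perm.
by apply/rowP => k; rewrite !mxE invgK addrN.
Qed.

Lemma Wtilde_comp h w : Wtilde h -> Wtilde w -> Wtilde (h \o w).
Proof. by move=> [s [v ->]] [s' [v' ->]]; rewrite affine_perm_comp; do 2 eexists. Qed.

Lemma Waff_Wtilde : @Waff d `<=` @Wtilde d.
Proof. by move=> _ [s [v [_ ->]]]; exists s, v. Qed.

Lemma Wtilde_sum h : Wtilde h -> exists n, forall b, \sum_k h b 0 k = \sum_k b 0 k + n.
Proof. by move=> [s [v ->]]; exists (\sum_k v 0 k) => b; rewrite sum_affine_perm. Qed.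

Lemma Waff_sum w b : Wtilde w -> \sum_k w b 0 k = \sum_k b 0 k -> Waff w.
Proof.
move=> [s [v ->]] sumE; exists s, v; split=> //.
by move: sumE; rewrite sum_affine_perm -[RHS]addr0 => /addrI.
Qed.

Lemma Wtilde_linked (h : transf d) b c : Wtilde h -> between b c -> between (h b) (h c).
Proof.
by move=> [s [v ->]] bc k; rewrite !affine_permE; have := bc (s^-1%g k); lia.
Qed.

Variables (I : finType) (a : I -> 'rV[int]_d) (T : {set I}).
Local Notation W := (Wstab a T).

Lemma Wstab_id : W id.
Proof.
split=> //; exists 1%g, 0; rewrite affine_perm_id; split=> //.
by apply: big1 => k _; rewrite mxE.
Qed.

Lemma Wstab_comp w w' : W w -> W w' -> W (w \o w').
Proof.
move=> [Ww wT] [Ww' wT']; split=> [|v vT] /=; last by rewrite wT' ?wT.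
have [s [v [v0 wE]]] := Ww; have [s' [v' [v'0 wE']]] := Ww'.
apply: (@Waff_sum _ 0); first by apply: Wtilde_comp; apply: Waff_Wtilde.
by rewrite /= wE sum_affine_perm v0 wE' sum_affine_perm v'0 !addr0.
Qed.

Lemma Wstab_inverse w : W w -> exists w', [/\ W w', w \o w' = id & w' \o w = id].
Proof.
move=> [Ww wT]; have [w' [Ww' ww' w'w]] := Wtilde_inverse (Waff_Wtilde Ww).
have w'K c : w (w' c) = c by rewrite -[RHS]/(id c) -ww'.
have wK c : w' (w c) = c by rewrite -[RHS]/(id c) -w'w.
exists w'; split=> //; split=> [|v vT]; last by rewrite -{1}(wT v vT) wK.
apply: (@Waff_sum _ 0) => //; have [s [v [v0 wE]]] := Ww.
by rewrite -[in RHS](w'K 0) wE sum_affine_perm v0 addr0.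
Qed.

(** The quotient [h^-1 h'] fixes [a v] on [T]. Its translation part has sum zero because an element
    of [Wtilde] shifts all coordinate sums by one constant, which is why [b] and [b'] may differ. *)
Lemma Wtilde_agree h h' : Wtilde h -> Wtilde h' ->
  (exists b b', \sum_k h b 0 k - \sum_k b 0 k = \sum_k h' b' 0 k - \sum_k b' 0 k) ->
  (forall v, v \in T -> h (a v) = h' (a v)) ->
  exists2 w, W w & h' = h \o w.
Proof.
move=> hW hW' [b [b' sumE]] agree.
have [g [gW hg gh]] := Wtilde_inverse hW.
have hK c : h (g c) = c by rewrite -[RHS]/(id c) -hg.
have gK c : g (h c) = c by rewrite -[RHS]/(id c) -gh.
exists (g \o h'); last by apply: funext => c /=; rewrite hK.
split=> [|v vT] /=; last by rewrite -agree.
apply: (@Waff_sum _ 0); first exact: Wtilde_comp.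
have [n nE] := Wtilde_sum hW; have [n' nE'] := Wtilde_sum hW'.
have := nE (g (h' 0)); rewrite hK nE' /=.
by move: sumE; rewrite nE nE'; lia.
Qed.

Lemma dcoset_sub h h' w w' : W w -> W w' -> h' = w \o h \o w' ->
  dcoset W h' `<=` dcoset W h.
Proof.
move=> Ww Ww' -> _ [u Wu [u' Wu' <-]].
exists (u \o w); first exact: Wstab_comp.
by exists (w' \o u') => //; exact: Wstab_comp.
Qed.

Lemma dcoset_eq h h' w w' : W w -> W w' -> h' = w \o h \o w' ->
  dcoset W h = dcoset W h'.
Proof.
move=> Ww Ww' hE; apply/seteqP; split; last exact: dcoset_sub hE.
have [v [Wv vw wv]] := Wstab_inverse Ww; have [v' [Wv' vw' wv']] := Wstab_inverse Ww'.
apply: (@dcoset_sub _ _ v v') => //; rewrite hE; apply: funext => c /=.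
by rewrite -[w' (v' c)]/((w' \o v') c) vw' -[v (w _)]/((v \o w) _) wv.
Qed.

End WeylGroup.

(** * Pivots of a subspace *)

Section Pivots.
Variables (F : fieldType) (d : nat).
Implicit Types (E : set 'rV[F]_d) (key : 'I_d -> int).

Definition leads key (x : 'rV[F]_d) k : Prop :=
  x 0 k != 0 /\ forall l, key k < key l -> x 0 l = 0.

Definition pivots key E : {set 'I_d} :=
  [set k | `[< exists2 x, E x & leads key x k >]]%SET.

Lemma ex_leads key x : injective key -> x != 0 -> exists k, leads key x k.
Proof.
move=> key_inj /rV0Pn[k0 xk0].
case: (@Order.TotalTheory.arg_maxP _ _ _ k0 (fun k => x 0 k != 0) key xk0) => k xk kmax.
exists k; split=> // l kl; apply: contrapT => /eqP/kmax /(lt_le_trans kl).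
by rewrite ltxx.
Qed.

(** Gaussian elimination: for a pivot [k], an element of [E] leading at [k] rewrites the basis
    vector at [k] in terms of those with smaller key. *)
Lemma pivots_generate key E : injective key -> submodule E ->
  quotient_generated E [set k | k \notin pivots key E].
Proof.
move=> key_inj [E0 ED].
pose G (z : 'rV[F]_d) := exists x y : 'rV[F]_d,
  [/\ E x, forall k, y 0 k != 0 -> k \notin pivots key E & z = x + y].
have G0 : G 0 by exists 0, 0; split=> // [k|]; rewrite ?mxE ?eqxx ?addr0.
have GD c (z z' : 'rV[F]_d) : G z -> G z' -> G (c *: z + z').
  move=> [x [y [Ex yQ ->]]] [x' [y' [Ex' yQ' ->]]].
  exists (c *: x + x'), (c *: y + y'); split; first exact: ED.
    move=> k; rewrite !mxE; have [y0|/yQ //] := eqVneq (y 0 k) 0.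
    by rewrite y0 mulr0 add0r => /yQ'.
  by rewrite scalerDr addrACA.
have Gsum (z : 'rV[F]_d) : (forall k, z 0 k != 0 -> G (delta_mx 0 k)) -> G z.
  move=> Gz; rewrite [z]row_sum_delta; elim/big_ind: _ => // [u v|k _].
    by move=> Gu Gv; rewrite -[u]scale1r; exact: GD.
  have [->|/Gz Gk] := eqVneq (z 0 k) 0; first by rewrite scale0r.
  by rewrite -[_ *: _]addr0; exact: GD.
have Gdelta n : forall k, (#|[set l | (key l < key k)%R]%SET| < n)%N -> G (delta_mx 0 k).
  elim: n => // n IH k; rewrite ltnS => cardk.
  have [kP|kP] := boolP (k \in pivots key E); last first.
    exists 0, (delta_mx 0 k); split; rewrite ?add0r // => l.
    by rewrite mxE; case: (eqVneq l k) => [->|_]; rewrite ?andbF ?eqxx.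
  move: kP; rewrite inE => /asboolP[x Ex [xk xl]].
  pose z := delta_mx 0 k - (x 0 k)^-1 *: x.
  suff Gz : G z.
    have -> : delta_mx 0 k = (x 0 k)^-1 *: x + z by rewrite addrC subrK.
    by apply: GD => //; exists x, 0; split=> // [l|]; rewrite ?mxE ?eqxx ?addr0.
  apply: Gsum => l zl; apply: IH; apply: leq_trans cardk.
  have lk : key l < key k.
    rewrite ltNge; apply/negP => kl; case/eqP: zl; rewrite !mxE /=.
    have [->|neq] := eqVneq l k; first by rewrite mulVf ?subrr.
    suff /xl -> : key k < key l by rewrite mulr0 subr0.
    by rewrite lt_neqAle kl andbT; apply: contraNneq neq => /key_inj ->.
  apply: proper_card; apply/fintype.properP; split.
    by apply/fintype.subsetP => m; rewrite !inE => /lt_trans; apply.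
  by exists l; rewrite !inE ?ltxx.
move=> z; apply: Gsum => k _; exact: (Gdelta _ _ (ltnSn _)).
Qed.

Lemma rank_coord_mx_le (P : {set 'I_d}) : (\rank (coord_mx F (mem P)) <= #|P|)%N.
Proof.
have -> : coord_mx F (mem P) = \sum_(k in P) delta_mx k k.
  rewrite /coord_mx; apply/matrixP => i j; rewrite summxE !mxE.
  have [->|neq] := eqVneq i j; last first.
    rewrite mulr0n big1 // => k _; rewrite mxE; case: eqVneq => // <-.
    by rewrite eq_sym (negPf neq).
  rewrite mulr1n; case: (boolP (j \in P)) => jP.
    rewrite (bigD1 j) //= jP mxE !eqxx big1 ?addr0 // => k /andP[_ kj].
    by rewrite mxE eq_sym (negPf kj).
  by rewrite /= (negPf jP) big1 // => k kP; rewrite mxE; case: eqVneq => // jk; rewrite jk kP in jP.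
rewrite -sum1_card; elim/big_ind2: _ => [|A m B n Am Bn|k _].
- by rewrite mxrank0.
- by apply: leq_trans (mxrank_add _ _) _; exact: leq_add.
- by rewrite mxrank_delta.
Qed.

(** The upper bounds for [P] and its complement add up to [d], the rank of the identity, so both are
    attained. *)
Lemma rank_coord_mx (P : {set 'I_d}) : \rank (coord_mx F (mem P)) = #|P|.
Proof.
have add1 : coord_mx F (mem P) + coord_mx F (mem (~: P)) = 1%:M.
  apply/matrixP => i j; rewrite !mxE -mulrnDl /= inE.
  by case: (i \in P); rewrite ?addr0 ?add0r.
have := mxrank_add (coord_mx F (mem P)) (coord_mx F (mem (~: P))).
rewrite add1 mxrank1; have := rank_coord_mx_le P; have := rank_coord_mx_le (~: P).
by have := cardsC P; rewrite card_ord; lia.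
Qed.

(** The span of the non-pivot coordinates is a complement of [E]: together they generate everything,
    and a nonzero vector of [E] leads at a pivot. *)
Lemma card_pivots m key E (M : 'M[F]_(m, d)) : injective key ->
  E = range (fun x : 'rV_m => x *m M) -> #|pivots key E| = \rank M.
Proof.
move=> key_inj EM.
have Esub : submodule E.
  rewrite EM; split=> [|c _ _ [x _ <-] [y _ <-]]; first by exists 0; rewrite ?mul0mx.
  by exists (c *: x + y); rewrite // mulmxDl scalemxAl.
pose Q := (~: pivots key E)%SET; pose D := coord_mx F (mem Q).
have full : \rank (M + D)%MS = d.
  apply/eqP; rewrite -/(row_full _) -sub1mx; apply/row_subP => k.
  have [x [y [+ yQ ->]]] := pivots_generate key_inj Esub (row k 1%:M).
  rewrite EM => -[u _ <-]; apply: addmx_sub_adds; first exact: submxMl.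
  suff -> : y = y *m D by exact: submxMl.
  apply/rowP => l; rewrite mul_coord_mx; case: ifP => // /negbT NQ.
  by apply: contrapT => /eqP/yQ/= lP; move: NQ; rewrite /= finset.in_setC lP.
have cap0 : (M :&: D)%MS = 0.
  apply/eqP/rowV0P => y; rewrite sub_capmx => /andP[/submxP[u yu] /submxP[w yw]].
  apply: contrapT => /eqP/(ex_leads key_inj)[k yk].
  have kP : k \in pivots key E by rewrite inE; apply/asboolP; exists y; rewrite ?EM //; exists u.
  by have [] := yk; rewrite yw mul_coord_mx /= finset.in_setC kP eqxx.
have := mxrank_sum_cap M D; rewrite full cap0 mxrank0 rank_coord_mx.
by have := cardsC (pivots key E); rewrite card_ord -/Q; lia.
Qed.

(** When [P] lies on top in the key order, projecting onto [P] preserves the leading coordinate of a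
    vector leading in [P] and kills every vector leading elsewhere. The pivots of the projection are
    thus those of [E] in [P]. *)
Lemma card_pivots_proj m key E (M : 'M[F]_(m, d)) (P : {set 'I_d}) : injective key ->
  E = range (fun x : 'rV_m => x *m M) ->
  (forall k l, k \in P -> l \notin P -> key l < key k) ->
  #|pivots key E :&: P| = \rank (M *m coord_mx F (mem P)).
Proof.
move=> key_inj EM keyP; rewrite -(card_pivots key_inj (erefl _)); apply: eq_card => k.
rewrite !inE; apply/andP/asboolP => [[/asboolP[x Ex [xk xl]] kP]|[_ [u _ <-] []]].
  move: Ex; rewrite EM => -[u _ ux]; exists (u *m (M *m coord_mx F (mem P))); first by exists u.
  rewrite mulmxA ux; split=> [|l kl]; rewrite mul_coord_mx /= ?kP //.
  by case: ifP => // _; exact: xl.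
rewrite mulmxA mul_coord_mx /=; case: ifP => [kP xk xl|]; last by rewrite eqxx.
split=> //; apply/asboolP; exists (u *m M); first by rewrite EM; exists u.
split=> // l kl; have := xl l kl; rewrite mul_coord_mx /=; case: ifP => // /negbT lP _.
by have := keyP _ _ kP lP; rewrite ltNge ltW.
Qed.

End Pivots.

(** * Lattices in the standard apartment *)

Section StandardLattices.
Variables (R : idomainType) (pi : R) (d : nat).
Hypotheses (pi_neq0 : pi != 0) (pi_nunit : pi \isn't a GRing.unit).
Local Notation P := (tofrac pi).

Lemma tofrac_neq0 : P != 0.
Proof. by rewrite tofrac_eq0. Qed.

Lemma tofrac_expz_le (x : R) (m n : int) : tofrac x * P ^ m = P ^ n -> m <= n.
Proof.
move=> xmn; rewrite leNgt; apply/negP => nm; case/negP: pi_nunit.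
have [e mE] : exists e : nat, m = n + e.+1%:Z by exists (absz (m - n)).-1; lia.
have : tofrac x * P ^+ e.+1 = 1.
  apply: (mulIf (expfz_neq0 n tofrac_neq0)).
  by rewrite mul1r -{2}xmn mE expfzDr ?tofrac_neq0 // -mulrA [_ * P ^ n]mulrC.
rewrite -rmorphXn -rmorphM -tofrac1 => /eqP; rewrite tofrac_eq => /eqP xpi1.
by apply/unitrP; exists (x * pi ^+ e); rewrite [pi * _]mulrC -mulrA -exprSr.
Qed.

Lemma std_latticeE (b : 'rV[int]_d) :
  std_lattice pi b = [set y | exists x : 'rV[R]_d, y = \row_k (tofrac (x 0 k) * P ^ (- b 0 k))].
Proof.
apply/seteqP; split=> [_ [x _ <-]|_ [x ->]]; exists x => //.
  by apply/rowP => k; rewrite mul_mx_diag !mxE.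
by apply/rowP => k; rewrite mul_mx_diag !mxE.
Qed.

Lemma std_lattice_le (b c : 'rV[int]_d) :
  std_lattice pi b `<=` std_lattice pi c -> forall k, b 0 k <= c 0 k.
Proof.
move=> bc k.
have : std_lattice pi b
    (\row_l (tofrac ((delta_mx 0 k : 'rV[R]_d) 0 l) * P ^ (- b 0 l))).
  by rewrite std_latticeE; exists (delta_mx 0 k).
move=> /bc; rewrite std_latticeE => -[x /rowP/(_ k)].
rewrite !mxE !eqxx tofrac1 mul1r => /esym/tofrac_expz_le; lia.
Qed.

Lemma scale_std_lattice (b : 'rV[int]_d) :
  scale P^-1 (std_lattice pi b) = std_lattice pi (b + const_mx 1).
Proof.
have step (x : R) (n : int) : P^-1 * (tofrac x * P ^ (- n)) = tofrac x * P ^ (- (n + 1)).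
  by rewrite mulrCA opprD expfzDr ?tofrac_neq0 // [_ * P ^ (- 1)]mulrC.
rewrite !std_latticeE; apply/seteqP; split=> [_ [_ [x ->] <-]|_ [x ->]].
  by exists x; apply/rowP => k; rewrite !mxE step.
exists (\row_k (tofrac (x 0 k) * P ^ (- b 0 k))); first by exists x.
by apply/rowP => k; rewrite !mxE step.
Qed.

Variables (I : finType) (a : I -> 'rV[int]_d).

Lemma chain_ordered_chain (T : {set I}) : chain_ordered pi a T ->
  (exists v, v \in T) /\ chain (fun v : {v | v \in T} => a (val v)).
Proof.
move=> [v0 [p [permT pathT lastT]]].
have inT v : (v \in T) = (v \in v0 :: p) by rewrite (perm_mem permT) mem_enum.
split; first by exists v0; rewrite inT mem_head.
pose le_a := [rel u v | [forall k, a u 0 k <= a v 0 k]].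
have le_refl : reflexive le_a by move=> u; apply/forallP.
have le_trans' : transitive le_a.
  by move=> v u w /forallP uv /forallP vw; apply/forallP => k; apply: le_trans (uv k) (vw k).
have sortT : sorted le_a (v0 :: p).
  apply: sub_path pathT => u v /asboolP/std_lattice_le uv; exact/forallP.
have mono u v : u \in v0 :: p -> v \in v0 :: p ->
    (index u (v0 :: p) <= index v (v0 :: p))%N -> forall k, a u 0 k <= a v 0 k.
  move=> uT vT uv; apply/forallP.
  have := sorted_leq_nth le_trans' le_refl v0 sortT (index u (v0 :: p)) (index v (v0 :: p)).
  by rewrite !inE !index_mem uT vT !nth_index // => /(_ isT isT uv).
(* The ordering closes up cyclically: [a v <= a (last v0 p) <= a v0 + 1 <= a u + 1]. *)
have near u v k : u \in v0 :: p -> v \in v0 :: p -> a v 0 k <= a u 0 k + 1.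
  move=> uT vT; have := mono v0 u (mem_head _ _) uT.
  have := mono v (last v0 p) vT (mem_last _ _).
  have uniqT : uniq (v0 :: p) by rewrite (perm_uniq permT) enum_uniq.
  rewrite [index v0 _]/= eqxx index_last // -ltnS -/(size (v0 :: p)) index_mem vT.
  move=> /(_ isT) le_v /(_ isT) le_u.
  have : forall k, a (last v0 p) 0 k <= (a v0 + const_mx 1) 0 k.
    by apply: std_lattice_le; rewrite -scale_std_lattice.
  move=> /(_ k); rewrite !mxE => le_last; apply: le_trans (le_v k) (le_trans le_last _).
  by rewrite lerD2r.
move=> [u uT'] [v vT'] /=; have uT : u \in v0 :: p by rewrite -inT.
have vT : v \in v0 :: p by rewrite -inT.
have [uv|/ltnW vu] := leqP (index u (v0 :: p)) (index v (v0 :: p)); [left|right] => k.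
  by rewrite near // andbT; exact: mono.
by rewrite near // andbT; exact: mono.
Qed.

End StandardLattices.

(** * Torus-fixed limits of field-valued points *)

Section PivotPoints.
Variables (F : fieldType) (d : nat) (I : finType) (a : I -> 'rV[int]_d).
Variables (E : I -> set 'rV[F]_d) (key : I -> 'I_d -> int).

(** The vector of the lattice [t^-1] times the preimage of the coordinate subspace on the pivots. *)
Definition pivot_point v : 'rV[int]_d :=
  \row_k (a v 0 k + (k \in pivots (key v) (E v))%:Z).

Lemma pivot_pointE v k :
  pivot_point v 0 k = a v 0 k + (k \in pivots (key v) (E v))%:Z.
Proof. by rewrite mxE. Qed.

Lemma between_pivot_point v : between (a v) (pivot_point v).
Proof. by move=> k; rewrite pivot_pointE; case: (k \in _); lia. Qed.

Lemma pivot_point_eq v k :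
  (pivot_point v 0 k == a v 0 k + 1) = (k \in pivots (key v) (E v)).
Proof. by rewrite pivot_pointE; case: (k \in _); lia. Qed.

End PivotPoints.

Section FieldPoints.
Variables (R : idomainType) (pi : R) (d : nat) (I : finType).
Variables (a : I -> 'rV[int]_d) (r : nat).
Hypothesis pi_neq0 : pi != 0.

Lemma LG_diag (A : comNzRingType) (f : {rmorphism R -> A}) E u v (n : int) :
  LG pi a r f E -> (forall k, a u 0 k <= a v 0 k + n) ->
  forall x, E u x -> E v (x *m diag_mx (\row_k f pi ^+ absz (a v 0 k + n - a u 0 k)%R)).
Proof.
move=> [_ Elink] uv x Eux.
pose M : 'M[R]_d := diag_mx (\row_k pi ^+ absz (a v 0 k + n - a u 0 k)%R).
have -> : diag_mx (\row_k f pi ^+ absz (a v 0 k + n - a u 0 k)%R) = map_mx f M.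
  by rewrite map_diag_mx; congr diag_mx; apply/rowP => k; rewrite !mxE rmorphXn.
apply: (Elink u v n M) => //.
rewrite map_diag_mx mulmx_diag -linearZ; congr diag_mx; apply/rowP => k.
have e_ge0 : 0 <= a v 0 k + n - a u 0 k by have := uv k; lia.
rewrite !mxE rmorphXn (_ : tofrac pi ^+ _ = tofrac pi ^ (a v 0 k + n - a u 0 k)).
  by rewrite -!expfzDr ?tofrac_neq0 //; congr (_ ^ _); lia.
by rewrite -[in RHS](gez0_abs e_ge0).
Qed.

Variables (F : fieldType) (f : {rmorphism R -> F}) (E : I -> set 'rV[F]_d).
Variable key : I -> 'I_d -> int.
Hypotheses (LG_E : LG pi a r f E) (key_inj : forall v, injective (key v)).
Local Notation pivot_point := (pivot_point a E key).

Lemma card_pivots_LG v : #|pivots (key v) (E v)| = r.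
Proof.
have [M /eqP Mfree EM] := sub_bundle_rank (LG_E.1 v).
by rewrite (card_pivots (@key_inj v) EM).
Qed.

Lemma sum_pivot_point v : \sum_k pivot_point v 0 k - \sum_k a v 0 k = r%:Z.
Proof.
under eq_bigr do rewrite pivot_pointE.
rewrite big_split /= addrC addrK -(card_pivots_LG v) -sum1_card.
rewrite (big_morph Posz PoszD erefl) [in RHS]big_mkcond /=.
by apply: eq_bigr => k _; case: (k \in _).
Qed.

Lemma pivot_generate v :
  quotient_generated (E v) [set k | pivot_point v 0 k = a v 0 k].
Proof.
have Esub : submodule (E v) by case: (LG_E.1 v).
move=> z; have [x [y [Ex yQ ->]]] := pivots_generate (@key_inj v) Esub z.
exists x, y; split=> // k /yQ /=; rewrite pivot_pointE => /negPf ->.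
by rewrite addr0.
Qed.

(** What makes the linked map take a vector leading at [k] to one leading at [k]: a coordinate above
    [k] at [v] is above [k] at [u] already, or is killed. The second alternative lets the order vary
    with the vertex. *)
Definition compatible u v (n : int) : Prop := forall k l,
  a u 0 k = a v 0 k + n -> key v k < key v l ->
  key u k < key u l \/ (f pi = 0 /\ a u 0 l <> a v 0 l + n).

(** Where equality holds in [a], the diagonal entry of the linked map is 1 and leading coordinates
    are transported; elsewhere the gap of at least 1 absorbs the pivot. *)
Lemma pivot_point_le u v n : compatible u v n ->
  (forall k, a u 0 k <= a v 0 k + n) ->
  forall k, pivot_point u 0 k <= pivot_point v 0 k + n.
Proof.
move=> key_uv uv k; rewrite !pivot_pointE.
have [kn|kn] := eqVneq (a u 0 k) (a v 0 k + n); last first.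
  by have := uv k; case: (k \in pivots (key u) _); case: (k \in pivots (key v) _); lia.
suff kP : k \in pivots (key u) (E u) -> k \in pivots (key v) (E v).
  move: kP; case: (k \in pivots (key u) _) => [/(_ isT) ->|_]; first by rewrite kn; lia.
  by case: (k \in pivots (key v) _); lia.
rewrite !inE => -[x Ex [xk xl]].
exists (x *m diag_mx (\row_k f pi ^+ absz (a v 0 k + n - a u 0 k)%R)).
  exact: LG_diag Ex.
split=> [|l kl]; rewrite mul_mx_diag !mxE.
  by rewrite kn subrr expr0 mulr1.
have [/xl ->|[-> ln]] := key_uv k l kn kl; first by rewrite mul0r.
rewrite expr0n; case: eqP => [l0|]; last by rewrite mulr0.
by case: ln; have := uv l; lia.
Qed.

(** The maps [L_u -> L_v] and [pi : L_v -> L_u] give the two inequalities of [linked]. All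
    coordinate sums exceed those of [a] by [r], so [chain_affine] applies. *)
Lemma pivot_point_affine (T : {set I}) : (exists v, v \in T) ->
  chain (fun v : {v | v \in T} => a (val v)) ->
  (forall u v n, u \in T -> v \in T -> compatible u v n) ->
  linked (fun v : {v | v \in T} => a (val v)) (fun v => pivot_point (val v)) /\
  exists h, [/\ Wtilde h, admissible a r h T & forall v, v \in T -> h (a v) = pivot_point v].
Proof.
move=> [v0 v0T] chainT compT.
have linkT : linked (fun v : {v | v \in T} => a (val v)) (fun v => pivot_point (val v)).
  move=> [u uT] [v vT] /= uv k; apply/andP; split.
    rewrite -[leRHS]addr0; apply: pivot_point_le => [|l]; first exact: compT.
    by have := uv l; lia.
  by apply: pivot_point_le => [|l]; [exact: compT|have := uv l; lia].
split=> //.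
have [u v|s [w swP]] := chain_affine chainT (exist _ v0 v0T) linkT.
  have sumE w : \sum_k pivot_point w 0 k = r%:Z + \sum_k a w 0 k.
    by apply/eqP; rewrite -subr_eq sum_pivot_point.
  by rewrite !sumrB /= !sumE opprD addrACA subrr add0r.
have hP v : v \in T -> affine_perm s w (a v) = pivot_point v.
  by move=> vT; have := swP (exist _ v vT).
exists (affine_perm s w); split=> //; first by exists s, w.
move=> v vT; rewrite hP //; split; last exact: sum_pivot_point.
exact: between_pivot_point.
Qed.

End FieldPoints.

(** * Openness of the sets [U] and the covering property *)

Section Cover.
Variables (R : idomainType) (pi : R) (d : nat) (I : finType).
Variables (a : I -> 'rV[int]_d) (r : nat).
Hypotheses (pi_neq0 : pi != 0) (pi_nunit : pi \isn't a GRing.unit).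
Hypothesis chains : forall j : maxsimplex pi a, chain_ordered pi a (val j).

(* The order on coordinates need not be adapted to the simplices: the limits
   for the standard order are already linked over all of [Gamma]. *)
Lemma field_point_adm (F : fieldType) (f : {rmorphism R -> F}) E :
  LG pi a r f E -> exists2 x, adm pi a r x &
    forall j, exists2 x', same_dcoset_tuples r x x' &
      forall v : vertex_of j,
        quotient_generated (E (val v)) [set k | x' v 0 k = a (val v) 0 k].
Proof.
(* One order for all vertices is compatible with every linked map, even where [pi] is invertible,
   and the pivots at a vertex do not depend on the simplex containing it. *)
move=> LGE; pose key (_ : I) (k : 'I_d) : int := (k : nat)%:Z.
have key_inj v : injective (key v) by move=> k l [/val_inj].
have /choice[h hP] : forall j : maxsimplex pi a, exists h, [/\ Wtilde h,
    admissible a r h (val j) &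
    forall v, v \in val j -> h (a v) = pivot_point a E key v].
  move=> j; have [exT chainT] := chain_ordered_chain pi_neq0 pi_nunit (chains j).
  have [] := pivot_point_affine pi_neq0 LGE key_inj exT chainT; last by [].
  by move=> u v n _ _ k l _ kl; left.
pose x j := Defs.coset (h j) (Wstab a (val j)).
have xE j h' : x j h' -> Wtilde h' /\
    forall v, v \in val j -> h' (a v) = pivot_point a E key v.
  have [hW _ hE] := hP j; move=> [w [Ww wE] <-]; split=> [|v vj /=].
    by apply: Wtilde_comp => //; exact: Waff_Wtilde.
  by rewrite wE // hE.
have x_refl j : x j (h j) by exists id => //; exact: Wstab_id.
exists x.
  split=> [j|j j' h1 h2 /xE[h1W h1E] /xE[h2W h2E]].
    by exists (h j); have [] := hP j.
  (* Both maps give the pivot vectors on the common vertices, so they differ by a stabilizing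
     element on the right. *)
  have [|v|w Ww ->] := @Wtilde_agree _ _ a (val j :&: val j')%SET h1 h2 h1W h2W.
  - have [[v vj] _] := chain_ordered_chain pi_neq0 pi_nunit (chains j).
    have [[v' vj'] _] := chain_ordered_chain pi_neq0 pi_nunit (chains j').
    by exists (a v), (a v'); rewrite h1E // h2E // !(sum_pivot_point LGE key_inj).
  - by rewrite inE => /andP[vj vj']; rewrite h1E ?h2E.
  - by apply: (@dcoset_eq _ _ _ _ _ _ id w) => //; exact: Wstab_id.
move=> j; have [hW hadm hE] := hP j.
exists (fun v => h j (a (val v))); first by exists (h j), (h j).
by move=> v; rewrite hE ?(valP v) //; exact: pivot_generate LGE key_inj _.
Qed.

Lemma open_cover_U : open_cover (LG pi a r) (adm pi a r) (U pi a r).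
Proof.
split=> [x _ A f E [] //|A f E LGE].
pose Phi (x : collection pi a) (F : fieldType) (g : {rmorphism A -> F}) : Prop :=
  forall j, exists2 x', same_dcoset_tuples r x x' &
    forall v : vertex_of j, quotient_generated (base_change g (E (val v)))
      [set k | x' v 0 k = a (val v) 0 k].
have Phi_open x : open_points (Phi x).
  apply: (@open_points_forall _ {T : {set I} | maximal_simplex pi a T}) => j.
  apply: open_points_exists => x' _.
  apply: (@open_points_forall _ {v : I | v \in val j}) => v.
  have [P EP] := sub_bundle_projector (LGE.1 (val v)).
  exact: open_quotient_generated EP.
(* All functions whose nonvanishing locus lies in the pullback of [U x]; as this pullback is open,
   they cut out exactly its complement. *)
pose S x : set A := [set s | forall (F : fieldType) (g : {rmorphism A -> F}),
  g s != 0 -> Phi x F g].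
have comp (B : comNzRingType) (g : {rmorphism A -> B}) (F : fieldType)
    (h : {rmorphism B -> F}) v :
    base_change h (base_change g (E v)) = base_change (h \o g) (E v).
  by have [P EP] := sub_bundle_projector (LGE.1 v); exact: base_change_comp EP.
exists S; split=> [x admx B g|]; last first.
  apply/unit_idealP => F g.
  have [x admx Phix] := field_point_adm (LG_base_change g LGE).
  by have [s gs sP] := Phi_open x F g Phix; exists s => //; exists x.
split=> [[_ PhiB]|/unit_idealP Sg].
  apply/unit_idealP => F h.
  have /Phi_open[s hgs sP] : Phi x F (h \o g).
    by move=> j; have [x' xx' x'P] := PhiB F h j; exists x' => // v; rewrite -comp.
  by exists (g s) => //; exists s.
split; first exact: LG_base_change.
move=> F h j; have [_ [s sP <-] hgs] := Sg F h.
have [x' xx' x'P] := sP F (h \o g) hgs j.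
by exists x' => // v; rewrite comp.
Qed.

End Cover.

(** * Bruhat strata *)

Section PowerSeries.
Variable k : fieldType.

Fact ps_coef0_zmod_morphism : zmod_morphism (@ps_coef0 k).
Proof. by []. Qed.

Fact ps_coef0_monoid_morphism : monoid_morphism (@ps_coef0 k).
Proof. by split=> // f g; rewrite /ps_coef0 /= big_ord1. Qed.

HB.instance Definition _ :=
  GRing.isZmodMorphism.Build (power_series k) k (@ps_coef0 k) ps_coef0_zmod_morphism.
HB.instance Definition _ :=
  GRing.isMonoidMorphism.Build (power_series k) k (@ps_coef0 k) ps_coef0_monoid_morphism.

Lemma ps_t_neq0 : ps_t k != 0.
Proof.
by apply/eqP => /(congr1 (fun f => coefs f 1)) /= /eqP; rewrite oner_eq0.
Qed.

End PowerSeries.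

(** [G] records the images of the basis and [G'] the preimages, both integral because the lattice is
    mapped onto itself. *)
Lemma row_lattice_stabilizer (R : idomainType) d (B g : 'M[{fraction R}]_d) :
  B \in unitmx ->
  [set y *m g | y in row_lattice B] = row_lattice B ->
  exists G G' : 'M[R]_d, B *m g = map_mx (@tofrac R) G *m B /\ G' *m G = 1%:M.
Proof.
move=> Bunit stab.
have rowB k : row_lattice B (row k B).
  by exists (delta_mx 0 k); rewrite // map_delta_mx -rowE.
have /choice[x xP] : forall k, exists x : 'rV[R]_d, map_mx (@tofrac R) x *m B = row k B *m g.
  move=> k; have [x _ xE] : row_lattice B (row k B *m g) by rewrite -stab; exists (row k B).
  by exists x.
have /choice[x' xP'] : forall k, exists x : 'rV[R]_d,
    map_mx (@tofrac R) x *m B *m g = row k B.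
  move=> k; have [_ [z _ <-] zE] : [set y *m g | y in row_lattice B] (row k B) by rewrite stab.
  by exists z.
pose G := \matrix_k x k; pose G' := \matrix_k x' k.
have GE : B *m g = map_mx (@tofrac R) G *m B.
  by apply/row_matrixP => k; rewrite !row_mul -xP -map_row rowK.
exists G, G'; split=> //.
have G'E : map_mx (@tofrac R) G' *m B *m g = B.
  by apply/row_matrixP => k; rewrite !row_mul -map_row rowK xP'.
have : map_mx (@tofrac R) (G' *m G) = map_mx (@tofrac R) 1%:M.
  have <- : map_mx (@tofrac R) G' *m B *m g *m invmx B = map_mx (@tofrac R) 1%:M.
    by rewrite G'E mulmxV // map_mx1.
  by rewrite -[_ *m B *m g]mulmxA GE mulmxA -map_mxM mulmxK.
by move=> /matrixP eqG; apply/matrixP => i j; have := eqG i j;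
  rewrite !mxE => /eqP; rewrite tofrac_eq => /eqP.
Qed.

Section Stratum.
Variables (R : idomainType) (pi : R) (d : nat) (I : finType).
Variables (a : I -> 'rV[int]_d) (r : nat).
Variables (kappa : fieldType) (red : {rmorphism R -> kappa}).
Local Notation t := (ps_t kappa).
Local Notation tofr := (@tofrac (power_series kappa)).
Local Notation coef0 := (@ps_coef0 kappa).

Variables (T : {set I}) (h : transf d) (g : 'M[{fraction power_series kappa}]_d).
Variable E : I -> set 'rV[kappa]_d.
Let X : finType := {v : I | v \in T}.
Let aX (v : X) := a (val v).
(** For a vertex [v] of [T], when [aX] is a chain, this is a constant minus the number of [w] whose
    linked map from [v] kills the coordinate [k]. *)
Let height v k : int := \sum_(w : X) (a v 0 k - aX w 0 k).
(** Height first, index as tie-breaker; the factor [d] exceeds every index. *)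
Let key v (k : 'I_d) : int := d%:Z * height v k + (k : nat)%:Z.

Lemma key_lt u v k l : height u k < height v l -> key u k < key v l.
Proof.
move=> kl; have : d%:Z * height u k + d%:Z <= d%:Z * height v l.
  by rewrite -[X in _ + X]mulr1 -mulrDr ler_wpM2l // -ltzD1 ltrD2r.
by rewrite /key; have := ltn_ord k; have := ltn_ord l; lia.
Qed.

Lemma key_inj v : injective (key v).
Proof.
move=> k l kl; have [lt_kl|lt_lk|eq_kl] := ltgtP (height v k) (height v l).
- by have := key_lt lt_kl; rewrite kl ltxx.
- by have := key_lt lt_lk; rewrite kl ltxx.
- by apply: val_inj; move: kl; rewrite /key eq_kl => /addrI[].
Qed.

Hypotheses (pi_neq0 : pi != 0) (red_pi : red pi = 0).
Hypotheses (exT : exists v, v \in T) (LG_E : LG pi a r red E).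
Hypothesis chainT : chain aX.
Hypotheses (hW : Wtilde h) (h_adm : admissible a r h T) (gP : parahoric a T g).
Hypothesis orbit_E : forall v, v \in T ->
  scale (tofr t)^-1 (preimage_lattice a v (E v)) =
  [set y *m g | y in std_lattice t (h (a v))].

Let full v : {set 'I_d} := [set k | h (a v) 0 k == a v 0 k + 1]%SET.

Lemma std_basis_unit (b : 'rV[int]_d) : std_basis t b \in unitmx.
Proof.
rewrite unitmxE det_diag unitfE; apply/prodf_neq0 => k _.
by rewrite mxE expfz_neq0 // tofrac_neq0 // ps_t_neq0.
Qed.

Lemma coef0_tX n : coef0 (t ^+ n) = (n == 0%N)%:R.
Proof. by rewrite rmorphXn expr0n. Qed.

(** [g] acts on each [Lambda(a_v)] by an integral invertible matrix, whose constant term is [G v].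
    Commutation of [g] with powers of [t] becomes commutation with the linked maps modulo [t], and
    the orbit condition presents the subspace at [v] as the image of a coordinate subspace. *)
Lemma reduction : exists G : X -> 'M[kappa]_d,
  [/\ forall v, G v \in unitmx,
      forall u v, G u *m coord_mx kappa (mem (kept aX aX u v)) =
                  coord_mx kappa (mem (kept aX aX u v)) *m G v &
      forall v, E (val v) =
        range (fun x : 'rV_d => x *m (coord_mx kappa (mem (full (val v))) *m G v))].
Proof.
have [_ gT] := gP.
have /choice[G GP] : forall v : X, exists G : 'M[power_series kappa]_d,
    std_basis t (aX v) *m g = map_mx tofr G *m std_basis t (aX v) /\
    map_mx coef0 G \in unitmx.
  move=> v; have [G [G' [GE G'G]]] :=
    row_lattice_stabilizer (std_basis_unit (aX v)) (gT _ (valP v)).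
  exists G; split=> //; have : map_mx coef0 G' *m map_mx coef0 G = 1%:M.
    by rewrite -map_mxM G'G map_mx1.
  by move=> /mulmx1_unit[].
have tofr_inj m n (A B : 'M[power_series kappa]_(m, n)) :
    map_mx tofr A = map_mx tofr B -> A = B.
  by move=> /matrixP AB; apply/matrixP => i j; have := AB i j;
    rewrite !mxE => /eqP; rewrite tofrac_eq => /eqP.
have cancel (b : 'rV[int]_d) m (A B : 'M[power_series kappa]_(m, d)) :
    map_mx tofr A *m std_basis t b = map_mx tofr B *m std_basis t b -> A = B.
  move=> AB; apply: tofr_inj.
  by rewrite -(mulmxK (std_basis_unit b) (map_mx tofr A)) AB mulmxK ?std_basis_unit.
have shift (b c : 'rV[int]_d) (n : int) : (forall k, b 0 k <= c 0 k + n) ->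
    tofr t ^ n *: std_basis t b =
    map_mx tofr (diag_mx (\row_k t ^+ absz (c 0 k + n - b 0 k)%R)) *m std_basis t c.
  move=> bc; rewrite map_diag_mx mulmx_diag -linearZ; congr diag_mx; apply/rowP => k.
  have e_ge0 : 0 <= c 0 k + n - b 0 k by have := bc k; lia.
  rewrite !mxE rmorphXn (_ : tofr t ^+ _ = tofr t ^ (c 0 k + n - b 0 k)).
    by rewrite -!expfzDr ?tofrac_neq0 ?ps_t_neq0 //; congr (_ ^ _); lia.
  by rewrite -[in RHS](gez0_abs e_ge0).
have reduce (b c : 'rV[int]_d) (n : int) : (forall k, b 0 k <= c 0 k + n) ->
    map_mx coef0 (diag_mx (\row_k t ^+ absz (c 0 k + n - b 0 k)%R)) =
    coord_mx kappa (mem [set k | c 0 k + n == b 0 k]%SET).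
  move=> bc; rewrite map_diag_mx; congr diag_mx; apply/rowP => k.
  by rewrite !mxE /= coef0_tX inE absz_eq0 subr_eq0.
exists (fun v => map_mx coef0 (G v)); split=> [v|u v|v].
- by have [] := GP v.
- have uv k : aX u 0 k <= aX v 0 k + turn aX u v.
    by have := turn_between chainT u v k (fun _ _ => id); lia.
  rewrite -(reduce _ _ _ uv) -!map_mxM; congr map_mx; apply: (cancel (aX v)).
  have [GuE _] := GP u; have [GvE _] := GP v.
  rewrite !map_mxM -!mulmxA -GvE -(shift _ _ _ uv) mulmxA -(shift _ _ _ uv).
  by rewrite -scalemxAl GuE scalemxAr.
have [GvE _] := GP v; pose b := aX v; pose x := h (aX v).
have xb k : x 0 k <= b 0 k + 1 by have [/(_ k)/andP[]] := h_adm (valP v).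
(* [D] expresses the basis of [t Lambda(h a_v)] in that of [Lambda(a_v)]; admissibility makes it
   integral. *)
pose D := diag_mx (\row_k t ^+ absz (b 0 k + 1 - x 0 k)%R).
have orbitE (y z : 'rV[power_series kappa]_d) :
    (tofr t)^-1 *: (map_mx tofr y *m std_basis t b) = map_mx tofr z *m std_basis t x *m g <->
    y = z *m (D *m G v).
  have t0 : tofr t != 0 by rewrite tofrac_neq0 // ps_t_neq0.
  have -> : map_mx tofr z *m std_basis t x *m g =
      (tofr t)^-1 *: (map_mx tofr (z *m (D *m G v)) *m std_basis t b).
    rewrite !map_mxM -!mulmxA -GvE [in RHS](mulmxA (map_mx tofr D)) -(shift _ _ _ xb).
    by rewrite expr1z -scalemxAl -scalemxAr scalerA mulVf // scale1r.
  split=> [/(congr1 (fun w => tofr t *: w))|-> //].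
  by rewrite !scalerA !divff // !scale1r; exact: cancel.
have DE : map_mx coef0 D = coord_mx kappa (mem (full (val v))).
  rewrite (reduce _ _ _ xb); congr diag_mx; apply/rowP => k.
  by rewrite !mxE /= !inE eq_sym.
(* Any lift will do; here every coefficient is taken equal to the constant one. *)
have lift (w : 'rV[kappa]_d) : exists y : 'rV[power_series kappa]_d, map_mx coef0 y = w.
  exists (map_mx (fun c => PowerSeries (fun=> c)) w).
  by apply/rowP => k; rewrite !mxE.
apply/seteqP; split=> [w Ew|_ [w _ <-]].
  have [y yw] := lift w.
  have : scale (tofr t)^-1 (preimage_lattice a (val v) (E (val v)))
      ((tofr t)^-1 *: (map_mx tofr y *m std_basis t b)).
    by exists (map_mx tofr y *m std_basis t b) => //; exists y; rewrite //= yw.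
  rewrite (orbit_E (valP v)) => -[_ [z _ <-] /esym/orbitE yz].
  by exists (map_mx coef0 z) => //; rewrite -DE -!map_mxM -yz.
have [z zw] := lift w.
have : [set y *m g | y in std_lattice t (h (a (val v)))] (map_mx tofr z *m std_basis t x *m g).
  by exists (map_mx tofr z *m std_basis t x) => //; exists z.
rewrite -(orbit_E (valP v)) => -[_ [y Ey <-] /orbitE yz].
by rewrite -zw -DE -!map_mxM -yz.
Qed.

(** Coordinates that do not survive are killed, since [red pi = 0]. On surviving ones the heights at
    [u] and [v] differ by one constant, so the two orders agree. *)
Lemma key_compatible u v n : compatible pi a red key u v n.
Proof.
move=> k l kn kl; have [ln|/eqP ln] := eqVneq (a u 0 l) (a v 0 l + n); last by right.
left; have heightE m : a u 0 m = a v 0 m + n -> height u m = height v m + \sum_(w : X) n.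
  by move=> mn; rewrite -big_split; apply: eq_bigr => w _; rewrite mn addrAC.
by move: kl; rewrite /key (heightE k) // (heightE l) // !mulrDr; lia.
Qed.

(* The coordinates killed by the linked map from [u] to [v] come last. *)
Lemma key_kept (u v : X) k l : k \in kept aX aX u v -> l \notin kept aX aX u v ->
  key (val u) l < key (val u) k.
Proof.
move=> kuv luv; apply: key_lt.
have al : linked aX aX by [].
have bound (w : X) m := turn_between chainT u w m al.
rewrite /height (bigD1 v) //= [ltRHS](bigD1 v) //=; apply: ltr_leD.
  by move: kuv luv; rewrite !inE -/(aX u); have := bound v k; have := bound v l; lia.
(* By nestedness, either [k] is kept towards [w] and its term is maximal, or [l] is not kept and its
   term is minimal. *)
apply: ler_sum => w _; have [nest|nest] := kept_nested chainT u v w.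
  have := fintype.subsetP (nest aX al) k kuv; rewrite inE -/(aX u).
  by have := bound w l; lia.
have : l \notin kept aX aX u w by apply: contra luv; exact/fintype.subsetP/nest.
by rewrite inE -/(aX u); have := bound w k; have := bound w l; lia.
Qed.

(** The limit of [E] for the adapted order [key] gives [h']; comparing the ranks of linked maps for
    [h] and [h'] identifies the double cosets. *)
Lemma stratum_point : exists h', [/\ Wtilde h', admissible a r h' T,
  dcoset (Wstab a T) h' = dcoset (Wstab a T) h &
  forall v, v \in T -> quotient_generated (E v) [set k | h' (a v) 0 k = a v 0 k]].
Proof.
have [linkT [h' [hW' h'_adm h'E]]] := pivot_point_affine pi_neq0 LG_E key_inj exT chainT
  (fun u v n _ _ => @key_compatible u v n).
exists h'; split=> //; last by move=> v vT; rewrite h'E //; exact: pivot_generate LG_E key_inj v.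
have [v0 v0T] := exT.
have [G [Gunit Gcomm EG]] := reduction.
have hlink : linked aX (fun v => h (aX v)) by move=> u v; exact: Wtilde_linked.
have hbetween (v : X) : between (aX v) (h (aX v)) by have [] := h_adm (valP v).
have [u v|s [w swP]] := chain_matching chainT (exist _ v0 v0T) hlink linkT hbetween
    (fun v => between_pivot_point a E key (val v)).
  transitivity #|full (val u) :&: kept aX aX u v|.
    by apply: eq_card => k; rewrite !inE andbC.
  transitivity #|pivots (key (val u)) (E (val u)) :&: kept aX aX u v|; last first.
    by apply: eq_card => k; rewrite [RHS]inE pivot_point_eq !finset.in_setI andbC.
  rewrite (card_pivots_proj (@key_inj (val u)) (EG u) (@key_kept u v)).
  (* The linked map has the same rank on the subspace at [u] as on the coordinate subspace given by
     [full], because the invertible matrices [G] intertwine. *)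
  rewrite -mulmxA Gcomm mulmxA mxrankMfree ?row_free_unit //.
  rewrite mulmx_diag -(rank_coord_mx kappa); congr (\rank (diag_mx _)).
  by apply/rowP => k; rewrite !mxE /= finset.in_setI -natrM mulnb.
(* [w0] is the left factor; then [w0 \o h] and [h'] agree on [T], which supplies the right
   factor. *)
pose w0 := affine_perm s w.
have w0T v : v \in T -> w0 (a v) = a v /\ w0 (h (a v)) = h' (a v).
  by move=> vT; have [w0a w0h] := swP (exist _ v vT); rewrite h'E.
have w0W : Wtilde w0 by exists s, w.
have w0stab : Wstab a T w0.
  split=> [|v /w0T[] //]; apply: (@Waff_sum _ _ (a v0)) => //.
  by rewrite (w0T v0 v0T).1.
have [|v /w0T[_ <-] //|w' Ww' h'w'] :=
    @Wtilde_agree _ _ a T (w0 \o h) h' (Wtilde_comp w0W hW) hW'.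
  by exists (a v0), (a v0); rewrite /= (w0T v0 v0T).2.
by apply/esym; apply: dcoset_eq h'w'.
Qed.

End Stratum.

Theorem proposition3p14 (R : idomainType) (pi : R) (kappa : closedFieldType)
    (red : {rmorphism R -> kappa}) (d r : nat)
    (Gamma : set (set (set 'rV[{fraction R}]_d)))
    (I : finType) (a : I -> 'rV[int]_d)
    (pi_unif : dvr_uniformizer pi) (red_residue : residue_map pi red)
    (r_gt0 : (0 < r)%N) (r_lt_d : (r < d)%N)
    (Gamma_convex : convex_lattice_configuration Gamma)
    (Gamma_std : Gamma `<=` standard_apartment pi)
    (a_reps : representatives pi a Gamma) :
  open_cover (LG pi a r) (adm pi a r) (U pi a r) /\
  forall x, adm pi a r x ->
    bruhat_stratum pi a r red x `<=` U pi a r x red.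
Proof.
have [pi_neq0 pi_nunit _] := pi_unif; have [_ _ chains] := a_reps.
split=> [|x [x_adm _] E [LGE strE]]; first exact: open_cover_U.
have red_pi : red pi = 0 by apply/red_residue.2; exists 1; rewrite mul1r.
split=> // F g j.
have [h [q [xh qP orbitE]]] := strE j.
have [h0 [h0W xE h0_adm]] := x_adm j.
have [exT chainT] := chain_ordered_chain pi_neq0 pi_nunit (chains j).
have [w [Ww wT] hE] : Defs.coset h0 (Wstab a (val j)) h by rewrite -xE.
have hW : Wtilde h by rewrite -hE; apply: Wtilde_comp => //; exact: Waff_Wtilde.
have h_adm : admissible a r h (val j).
  by move=> v vj; rewrite -hE /= wT //; exact: h0_adm.
have [h' [h'W h'_adm h'h h'E]] := stratum_point pi_neq0 red_pi exT LGE chainT hW h_adm qP orbitE.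
exists (fun v => h' (a (val v))); first by exists h, h'.
(* The stratum yields generation over [kappa], whereas [U] tests every field over [kappa];
   generation passes to [F] by base change. *)
move=> v; have [P EP] := sub_bundle_projector (LGE.1 (val v)).
apply: quotient_generated_base_change; last exact: h'E (valP v).
exact: projector_submodule (projector_base_change g EP).
Qed.
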